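(* Let $d\ge2$, $2-d<\alpha<2$ and $\nabla K(x)=x|x|^{\alpha-2}$. Suppose $\rho_{init}\in\mathcal{P}_{RD}(\mathbb{R}^d)$ is compactly supported and absolutely continuous with respect to Lebesgue measure. Suppose that there exist $c>0$, $r_0\in(0,1]$ and $\beta\in\left(\frac{d+\alpha-2}{d},1\right)$ such that the density $u_{init}$ of $\rho_{init}$ satisfies $$u_{init}(x)\ \ge\ \frac{c}{|x|^{d+\alpha-2}}\,\frac{1}{(-\log|x|)^{\beta}}\qquad\text{for all } 0<|x|<r_0.$$ Suppose finally that $\rho\in C([0,+\infty),\mathcal{P}_{RD}(\mathbb{R}^d))$ is a Lagrangian solution of the aggregation equation with initial data $\rho_{init}$. Then $\rho(t)(\{0\})>0$ for all $t>0$.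
   Context: $\mathcal{P}_{RD}(\mathbb{R}^d)$ is the set of Borel probability measures on $\mathbb{R}^d$ that can be written $\mu=m\delta+g$, where $m\in[0,\infty)$, $\delta$ is the Dirac mass at the origin, and $g\in L^1(\mathbb{R}^d)$ is nonnegative, radially symmetric and monotone decreasing (non-increasing) as a function of the radius. $C([0,+\infty),\mathcal{P}_{RD}(\mathbb{R}^d))$ denotes maps into $\mathcal{P}_{RD}(\mathbb{R}^d)$ (with finite second moments) continuous with respect to the quadratic Wasserstein distance $W_2$. $\rho\in C([0,+\infty),\mathcal{P}_{RD}(\mathbb{R}^d))$ is a Lagrangian solution of the aggregation equation with initial data $\rho_{init}$ if there is a continuous map $\sigma:[0,+\infty)\times\mathbb{R}^d\to\mathbb{R}^d$, $(t,x)\mapsto\sigma^t(x)$, such that $\rho(t)=\sigma^t\#\rho_{init}$ (push-forward) for all $t\ge0$ and $\sigma^t(x)=x+\int_0^t v(\sigma^s(x),s)\,ds$ for all $x\in\mathbb{R}^d,t\ge0$, where $v(x,t)=-(\nabla K*\rho(t))(x)=-\int\nabla K(x-y)\,d\rho(t)(y)$ for $x\neq0$ and $v(0,t)=0$. *)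

(* Defs.v *)
From HB Require Import structures.
From mathcomp Require Import all_boot all_order all_algebra.
From mathcomp Require Import all_classical all_reals all_analysis.
From mathcomp Require Import measurable_realfun.

Set Implicit Arguments.
Unset Strict Implicit.
Unset Printing Implicit Defensive.
Import Order.TTheory GRing.Theory Num.Theory.
Import numFieldNormedType.Exports.

Local Open Scope classical_set_scope.
Local Open Scope ring_scope.

(* The Borel sigma-algebra of R^n, generated by the open sets. The norm [`|x|]
   of 'rV[R]_n is the sup norm; its topology is the Euclidean one. *)
Definition borel_rV_display : measure_display.
Proof. exact: default_measure_display. Qed.

Section borel_rV.
Context {R : realType} {n : nat}.

Let borel := <<s @open 'rV[R]_n >>.

Let borel0 : borel set0. Proof. exact: sigma_algebra0. Qed.

Let borelC A : borel A -> borel (~` A). Proof. exact: sigma_algebraC. Qed.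

Let borel_bigcup (F : (set 'rV[R]_n)^nat) :
  (forall i, borel (F i)) -> borel (\bigcup_i F i).
Proof. exact: sigma_algebra_bigcup. Qed.

HB.instance Definition _ := @isMeasurable.Build borel_rV_display
  'rV[R]_n borel borel0 borelC borel_bigcup.

Lemma open_measurable_rV (U : set 'rV[R]_n) : open U -> measurable U.
Proof. by move=> oU; exact: sub_gen_smallest. Qed.

End borel_rV.

Section borel_rV_lemmas.
Context {R : realType}.

Lemma open_bigcup_ball_rat n (U : set 'rV[R]_n) : open U ->
  U = \bigcup_(q in [set q : 'rV[rat]_n * nat |
                     ball (map_mx ratr q.1 : 'rV[R]_n) q.2.+1%:R^-1 `<=` U])
        ball (map_mx ratr q.1 : 'rV[R]_n) q.2.+1%:R^-1.
Proof.
move=> oU; apply/seteqP; split => [x Ux|x [q /= qU]]; last exact: qU.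
have /nbhs_ballP[e /= e0 xeU] : nbhs x U by exact: open_nbhs_nbhs.
have [k ke] : exists k : nat, k.+1%:R^-1 < e / 2.
  have e20 : 0 < e / 2 by rewrite divr_gt0.
  exists (Num.bound (e / 2)^-1); rewrite invf_plt ?posrE//.
  rewrite (lt_trans (archi_boundP _)) ?invr_ge0 ?(ltW e20)//.
  by rewrite ltr_nat.
have k0 : 0 < k.+1%:R^-1 :> R by rewrite invr_gt0.
have qP i : exists q : rat, `|x 0 i - ratr q| < k.+1%:R^-1.
  have /rat_in_itvoo[q] : x 0 i - k.+1%:R^-1 < x 0 i + k.+1%:R^-1.
    by rewrite ltrBlDr -addrA ltrDl addr_gt0.
  rewrite in_itv/= => /andP[q1 q2]; exists q.
  by rewrite ltr_distlC q1.
have [f fP] := choice qP.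
have xq : ball (map_mx ratr (\row_i f i) : 'rV[R]_n) k.+1%:R^-1 x.
  split => // i j; rewrite !mxE (ord1 i) /ball/= distrC; exact: fP.
exists (\row_i f i, k) => //= y [_ qy]; apply: xeU; split => // i j.
have := ball_triangle (ball_sym (xq.2 i j)) (qy i j).
by apply: le_ball; rewrite (splitr e) lerD// ltW.
Qed.

Lemma continuous_measurable_rV m n (f : 'rV[R]_m -> 'rV[R]_n) :
  continuous f -> measurable_fun [set: _] f.
Proof.
move=> /continuousP cf.
apply: (measurability (@open 'rV[R]_n) erefl).
by move=> _ [U oU <-]; rewrite setTI; apply: open_measurable_rV; exact: cf.
Qed.

Lemma continuous_measurable_rV_R m (f : 'rV[R]_m -> measurableTypeR R) :
  continuous (f : 'rV[R]_m -> R) -> measurable_fun [set: _] f.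
Proof.
move=> /continuousP cf; apply: (measurability _ (RGenOpens.measurableE R)).
move=> _ [_ [a [b ->] <-]]; rewrite setTI.
by apply: open_measurable_rV; exact: cf.
Qed.

End borel_rV_lemmas.

Section row_cons.
Context {R : realType} {n : nat}.

Definition row_cons (p : measurableTypeR R * 'rV[R]_n) : 'rV[R]_n.+1 :=
  row_mx (p.1)%:M p.2.

Definition row_uncons (v : 'rV[R]_n.+1) : measurableTypeR R * 'rV[R]_n :=
  (v 0 0, rsubmx (v : 'rV_(1 + n))).

Lemma row_cons0 p : row_cons p 0 0 = p.1.
Proof.
rewrite /row_cons mxE; case: splitP => [k _|k /=]; last by rewrite add1n.
by rewrite mxE (ord1 k) eqxx mulr1n.
Qed.

Lemma row_consS p (j : 'I_n) : row_cons p 0 (rshift 1 j) = p.2 0 j.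
Proof. exact: row_mxEr. Qed.

Lemma row_consK : cancel row_cons row_uncons.
Proof.
move=> p; rewrite /row_uncons row_cons0 /row_cons row_mxKr.
by rewrite -surjective_pairing.
Qed.

Lemma row_unconsK : cancel row_uncons row_cons.
Proof.
move=> v; apply/rowP => i; case: (split_ordP (i : 'I_(1 + n))) => k ->.
  have -> : lshift n k = 0 by rewrite (ord1 k); exact/val_inj.
  by rewrite row_cons0.
by rewrite row_consS /= mxE.
Qed.

Lemma measurable_row_cons : measurable_fun [set: _] row_cons.
Proof.
apply: (measurability (@open 'rV[R]_n.+1) erefl).
move=> _ [U oU <-]; rewrite setTI (open_bigcup_ball_rat oU) preimage_bigcup.
rewrite bigcup_mkcond; apply: countable_bigcupT_measurable => // q.
case: ifPn => // _; set e := _^-1; set c := map_mx _ _; clearbody c.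
have -> : row_cons @^-1` ball c e =
    (ball (c 0 0) e) `*` (ball (row_uncons c).2 e).
  have e0 : 0 < e by rewrite invr_gt0.
  apply/seteqP; split => p /=.
    move=> [_ B]; split; first by rewrite -(row_cons0 p); exact: B.
    split => // i j; have := B i (rshift 1 j).
    by rewrite (ord1 i) row_consS /= mxE.
  move=> [B0 [_ B]]; split => // i j; rewrite (ord1 i).
  case: (split_ordP (j : 'I_(1 + n))) => k ->.
    have -> : lshift n k = 0 by rewrite (ord1 k); exact/val_inj.
    by rewrite row_cons0.
  by rewrite row_consS; have := B 0 k; rewrite mxE.
apply: measurableX.
  by apply: open_measurable; exact: ball_open.
by apply: open_measurable_rV; exact: ball_open.
Qed.

Lemma measurable_row_uncons : measurable_fun [set: _] row_uncons.
Proof.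
apply: measurable_fun_pair => /=.
  by apply: continuous_measurable_rV_R; exact: coord_continuous.
apply: continuous_measurable_rV.
exact: (@continuous_rsubmx R 1 1 n).
Qed.

End row_cons.

Section lebesgue_rV.
Local Open Scope ereal_scope.
Context {R : realType}.

Section step.
Context {n : nat} (m : {sigma_finite_measure set 'rV[R]_n -> \bar R}).

Definition lebesgue_rV_step : set 'rV[R]_n.+1 -> \bar R :=
  pushforward (@lebesgue_measure R \x m) row_cons.

Let lebesgue_rV_step0 : lebesgue_rV_step set0 = 0.
Proof. by rewrite /lebesgue_rV_step /pushforward preimage_set0 measure0. Qed.

Let lebesgue_rV_step_ge0 A : 0 <= lebesgue_rV_step A.
Proof. by apply: measure_ge0; exact: measurable_row_cons. Qed.

Let lebesgue_rV_step_sigma_additive : semi_sigma_additive lebesgue_rV_step.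
Proof.
by apply: measure_semi_sigma_additive; exact: measurable_row_cons.
Qed.

HB.instance Definition _ := isMeasure.Build _ _ _ lebesgue_rV_step
  lebesgue_rV_step0 lebesgue_rV_step_ge0 lebesgue_rV_step_sigma_additive.

Let lebesgue_rV_step_sigma_finite : sigma_finite [set: _] lebesgue_rV_step.
Proof.
have /sigma_finiteP[F [FT ndF Foo]] := sigma_finiteT (@lebesgue_measure R).
have /sigma_finiteP[G [GT ndG Goo]] := sigma_finiteT m.
exists (fun k => row_uncons @^-1` (F k `*` G k)).
  apply/esym/seteqP; split => // v _.
  have [k _ Fk] : (\bigcup_k F k) (row_uncons v).1 by rewrite -FT.
  have [l _ Gl] : (\bigcup_k G k) (row_uncons v).2 by rewrite -GT.
  exists (maxn k l) => //; split.
    by move: Fk; apply/subsetPset/ndF/leq_maxl.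
  by move: Gl; apply/subsetPset/ndG/leq_maxr.
move=> k; have [mF Fk] := Foo k; have [mG Gk] := Goo k; split.
  rewrite -[X in measurable X]setTI; apply: measurable_row_uncons => //.
  exact: measurableX.
rewrite /lebesgue_rV_step /pushforward -comp_preimage.
have -> : row_uncons \o row_cons = id :> (measurableTypeR R * 'rV[R]_n -> _).
  by apply/funext => p /=; rewrite row_consK.
by rewrite preimage_id product_measure1E// lte_mul_pinfty// ge0_fin_numE.
Qed.

HB.instance Definition _ := Measure_isSigmaFinite.Build _ _ _
  lebesgue_rV_step lebesgue_rV_step_sigma_finite.

End step.

(* Iterated product measure; see lebesgue_rV_box for its values on boxes. *)
Fixpoint lebesgue_rV n : {sigma_finite_measure set 'rV[R]_n -> \bar R} :=
  if n is k.+1 then lebesgue_rV_step (lebesgue_rV k) else \d_(0%R : 'rV[R]_0).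

Lemma measurable_box n (A : 'I_n -> set (measurableTypeR R)) :
  (forall i, measurable (A i)) ->
  measurable [set v : 'rV[R]_n | forall i, A i (v 0%R i)].
Proof.
move=> mA.
have -> : [set v : 'rV[R]_n | forall i, A i (v 0%R i)] =
    \bigcap_(i in [set: 'I_n]) ((fun v : 'rV[R]_n => v 0%R i) @^-1` A i).
  by apply/seteqP; split => v /= Av i => [_|]; exact: Av.
apply: fin_bigcap_measurable => // i _.
rewrite -[X in measurable X]setTI; apply: continuous_measurable_rV_R => //.
exact: coord_continuous.
Qed.

Lemma lebesgue_rV_box n (A : 'I_n -> set (measurableTypeR R)) :
  (forall i, measurable (A i)) ->
  lebesgue_rV n [set v : 'rV[R]_n | forall i, A i (v 0%R i)] =
  \prod_(i < n) lebesgue_measure (A i).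
Proof.
elim: n A => [|n IHn] A mA.
  by rewrite big_ord0 /= diracE mem_set//= => -[].
rewrite big_ord_recl -IHn; last by move=> i; exact: mA.
rewrite -product_measure1E//; last first.
  by apply: (@measurable_box _ (fun i => A (lift ord0 i))) => i; exact: mA.
rewrite /= /lebesgue_rV_step /pushforward; congr (_ _).
have liftE (j : 'I_n) : lift ord0 j = rshift 1 j by exact/val_inj.
apply/seteqP; split => p /=.
  move=> Ap; split; first by rewrite -(row_cons0 p); exact: Ap.
  by move=> i; rewrite -row_consS -liftE; exact: Ap.
move=> [A0 AS] i; case: (unliftP ord0 i) => [j|] ->; last by rewrite row_cons0.
by rewrite {2}liftE row_consS; exact: AS.
Qed.

End lebesgue_rV.

Section euclidean.
Context {R : realType} {d : nat}.
Implicit Types x y : 'rV[R]_d.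

Definition enorm x : R := Num.sqrt (\sum_i x 0 i ^+ 2).

(* At x = 0 the value is 0 whatever the convention for a power of 0. *)
Definition gradK (alpha : R) x : 'rV[R]_d := enorm x `^ (alpha - 2) *: x.

Definition rV_integrable d' (T : measurableType d')
    (mu : {measure set T -> \bar R}) (D : set T) (f : T -> 'rV[R]_d) :=
  forall i, mu.-integrable D (fun s => (f s 0 i)%:E).

Definition rV_integral d' (T : measurableType d')
    (mu : {measure set T -> \bar R}) (D : set T) (f : T -> 'rV[R]_d) :
    'rV[R]_d :=
  \row_i \int[mu]_(s in D) f s 0 i.

End euclidean.

Section measures.
Context {R : realType} {d : nat}.
Implicit Types mu nu : probability 'rV[R]_d R.

Definition msupport mu : set 'rV[R]_d :=
  [set x | forall U, open U -> U x -> (0 < mu U)%E].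

Definition density_of mu (u : 'rV[R]_d -> R) :=
  [/\ (lebesgue_rV d).-integrable [set: 'rV[R]_d] (fun x => (u x)%:E),
      forall x, 0 <= u x &
      forall A, measurable A ->
        mu A = (\int[lebesgue_rV d]_(x in A) (u x)%:E)%E].

(* The value at the origin is left free: the profile may blow up at 0+, in
   which case no real value at 0 could dominate it. *)
Definition radially_decreasing (g : 'rV[R]_d -> R) :=
  exists phi : R -> R,
    (forall r s, 0 < r -> r <= s -> phi s <= phi r) /\
    (forall x, x != 0 -> g x = phi (enorm x)).

Definition PRD mu :=
  exists (m : R) (g : 'rV[R]_d -> R),
    [/\ 0 <= m,
        (lebesgue_rV d).-integrable [set: 'rV[R]_d] (fun x => (g x)%:E),
        forall x, 0 <= g x,
        radially_decreasing g &
        forall A, measurable A ->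
          mu A = (m%:E * \d_(0%R : 'rV[R]_d) A
                  + \int[lebesgue_rV d]_(x in A) (g x)%:E)%E].

Definition finite_second_moment mu :=
  (\int[mu]_x (enorm x ^+ 2)%:E < +oo)%E.

Definition coupling mu nu :
    set (probability ('rV[R]_d * 'rV[R]_d)%type R) :=
  [set gamma | forall A, measurable A ->
     pushforward gamma fst A = mu A /\ pushforward gamma snd A = nu A].

Definition wasserstein2 mu nu : \bar R :=
  (ereal_inf [set \int[gamma]_p (enorm (p.1 - p.2) ^+ 2)%:E
             | gamma in coupling mu nu] `^ 2^-1)%E.

(* Only the restriction of rho to [0, +oo[ matters. *)
Definition PRD_curve (rho : R -> probability 'rV[R]_d R) :=
  (forall t, 0 <= t -> PRD (rho t) /\ finite_second_moment (rho t)) /\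
  (forall t0, 0 <= t0 ->
     (fun t => wasserstein2 (rho t) (rho t0))
       @ within [set t | 0 <= t] (nbhs t0) --> 0%E).

Definition velocity (alpha : R) (rho : R -> probability 'rV[R]_d R)
    (x : 'rV[R]_d) (t : R) : 'rV[R]_d :=
  if x == 0 then 0
  else - rV_integral (rho t) setT (fun y => gradK alpha (x - y)).

(* The integrability clause makes the time integral meaningful: Rintegral is
   total, with junk values on non-integrable functions. *)
Definition lagrangian_solution (alpha : R)
    (rho_init : probability 'rV[R]_d R)
    (rho : R -> probability 'rV[R]_d R) :=
  exists sigma : R -> 'rV[R]_d -> 'rV[R]_d,
    [/\ {within [set tx : R * 'rV[R]_d | 0 <= tx.1],
          continuous (fun tx => sigma tx.1 tx.2)},
        forall t, 0 <= t -> forall A, measurable A ->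
          rho t A = pushforward rho_init (sigma t) A &
        forall x t, 0 <= t ->
          let v := fun s => velocity alpha rho (sigma s x) s in
          rV_integrable (@lebesgue_measure R) `[0, t] v /\
          sigma t x = x + rV_integral (@lebesgue_measure R) `[0, t] v].

End measures.

(* Main.v *)
Require Import Defs.
From HB Require Import structures.
From mathcomp Require Import all_boot all_order all_algebra.
From mathcomp Require Import all_classical all_reals all_analysis.
From mathcomp Require Import measurable_realfun zify ring lra.
Import Order.TTheory GRing.Theory Num.Theory.
Import numFieldNormedType.Exports.

Set Implicit Arguments.
Unset Strict Implicit.
Unset Printing Implicit Defensive.

Local Open Scope classical_set_scope.
Local Open Scope ring_scope.

(** The proof follows the trajectories of the characteristic flow and shows that
    those starting close to the origin reach it before any prescribed time.

    The velocity. A radially decreasing measure is invariant under reflections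
    (because Lebesgue measure is, [lebesgue_rV_refl]), so the velocity at [x] is
    [- h x] for a scalar [h] depending only on the time and on [|x|]
    ([field_radial]). To bound [h] from below, place [x = r e_0] on the first
    axis and write [h r] as the difference of the integrals of the positive part
    of the kernel against the measure translated by [x] and by [- x]. Since the
    density decreases with the radius, one translate dominates the other on the
    half-space where the positive part lives, so the difference is nonnegative
    and is only made smaller by replacing the kernel by a sum of indicators of
    boxes below it ([field_ge_minorant]). A box contributes through its two end
    slabs, which compare the density at two consecutive scales. Summation by
    parts over the scales ([abel_bound]), which uses [2 - d < alpha], gives, for
    [M] the mass of a ball and [R_j] a geometric sequence of radii starting at
    [r / 2],
    [sum_(j <= N) R_j ^ (alpha - 2) M (R_j) <= C (h + R_N ^ (alpha - 2))]
    ([field_lower_bound]).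

    The flow. As [h >= 0], each coordinate of a trajectory keeps its sign and
    shrinks ([abs_decay]); in particular the mass of every ball centred at the
    origin can only grow with time. The hypothesis on the initial density gives
    [R ^ (alpha - 2) M (R) >= c (log (1 / R)) ^ (- beta)] initially, hence at all
    times. Summing this over the scales between [|x|] and 1 gives
    [h >= c (log (1 / |x|)) ^ (1 - beta)] ([rate_large]). By any fixed time
    points near the origin have thus been contracted by more than any power of
    [log (1 / |x|)] ([early_contraction]). The mass that came along now makes the
    single term [j = 0] of the sum larger than [(log (1 / |x|)) ^ 2]
    ([rate_superlinear]), and [l' >= c l ^ 2] for [l = log (1 / |x|)] blows up in
    finite time, as short as one likes if [|x|] is small enough
    ([reaches_origin]). So a whole ball, of positive initial mass, is mapped to
    the origin at time [t].

    No derivative of a trajectory is ever taken: the differential inequalities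
    are used in the form of backward Euler steps, [(1 + lam (b - a)) |y b| <=
    |y a|], along geometric sequences of radii. *)

(** * Lebesgue measure, the Euclidean norm and boxes *)

Lemma le_measureS d (T : measurableType d) (R : realType)
    (mu : {measure set T -> \bar R}) (A B : set T) :
  measurable A -> measurable B -> A `<=` B -> (mu A <= mu B)%E.
Proof. by move=> mA mB; apply: le_measure; rewrite inE. Qed.

Section lebesgue_rV_invariance.
Context {R : realType}.

Lemma measurable_coord n (i : 'I_n) :
  measurable_fun [set: 'rV[R]_n] (fun v => v 0 i : measurableTypeR R).
Proof. by apply: continuous_measurable_rV_R; exact: coord_continuous. Qed.

(** Countably many balls generate the open sets, and a ball of the sup norm is
    a finite intersection of conditions on the coordinates. *)
Lemma measurable_rV_of_coord d (T : measurableType d) n (f : T -> 'rV[R]_n) :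
  (forall i, measurable_fun setT (fun t => f t 0 i : measurableTypeR R)) ->
  measurable_fun setT f.
Proof.
move=> mf; apply: (measurability (@open 'rV[R]_n) erefl).
move=> _ [U oU <-]; rewrite setTI (open_bigcup_ball_rat oU) preimage_bigcup.
rewrite bigcup_mkcond; apply: countable_bigcupT_measurable => // q.
case: ifPn => // _; set e := _^-1; set c := map_mx _ _; clearbody c.
have e0 : 0 < e by rewrite invr_gt0.
have -> : f @^-1` ball c e =
    \bigcap_(i in [set: 'I_n]) ((fun t => f t 0 i) @^-1` ball (c 0 i) e).
  apply/seteqP; split => t /=; first by move=> [_ B] i _; exact: B.
  by move=> B; split => // j i; rewrite (ord1 j); exact: B.
apply: fin_bigcap_measurable => // i _.
rewrite -[X in measurable X]setTI; apply: mf => //.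
by apply: open_measurable; exact: ball_open.
Qed.

Lemma measurable_shift n (a : 'rV[R]_n) :
  measurable_fun [set: 'rV[R]_n] (fun v => v + a).
Proof.
apply: measurable_rV_of_coord => i.
under eq_fun do rewrite mxE.
by apply: measurable_funD => //; exact: measurable_coord.
Qed.

Lemma measurable_preim d1 d2 (T1 : measurableType d1) (T2 : measurableType d2)
  (f : T1 -> T2) A : measurable_fun setT f -> measurable A ->
  measurable (f @^-1` A).
Proof. by move=> mf mA; rewrite -[X in measurable X]setTI; exact: mf. Qed.

Lemma lebesgue_measure_shift (a : R) (A : set (measurableTypeR R)) :
  measurable A ->
  lebesgue_measure ((fun x => x + a) @^-1` A) = lebesgue_measure A.
Proof.
move=> mA.
pose f := (fun x => x + a) : measurableTypeR R -> measurableTypeR R.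
have mf : measurable_fun setT f by apply: measurable_funD.
suff : lebesgue_measure A = pushforward lebesgue_measure f A by move->.
apply: (lebesgue_measure_unique
  (mu := pushforward (@lebesgue_measure R) f)) => //= _ [[x y]] _ <-.
rewrite /pushforward.
have -> : f @^-1` `]x, y] = `]x - a, y - a]%classic.
  by apply/seteqP; split => z /=; rewrite /f !in_itv/= ltrBlDr lerBrDr.
rewrite !lebesgue_measure_itv/= !lte_fin ltrD2r -!EFinB.
by have -> : y - a - (x - a) = y - x by ring.
Qed.

(** By induction on the dimension: the measure is an iterated product, and a
    translation acts on each factor separately. *)
Lemma lebesgue_rV_shift n (a : 'rV[R]_n) A : measurable A ->
  lebesgue_rV n ((fun v => v + a) @^-1` A) = lebesgue_rV n A.
Proof.
elim: n a A => [|n IH] a A mA.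
  by congr (lebesgue_rV 0 _); apply/seteqP; split => v; rewrite /= [v + a]thinmx0 [v]thinmx0.
pose T := (fun p => (p.1 + a 0 0, p.2 + rsubmx (a : 'rV_(1 + n)))) :
  measurableTypeR R * 'rV[R]_n -> measurableTypeR R * 'rV[R]_n.
have mT : measurable_fun setT T.
  apply: measurable_fun_pair => /=.
    apply: (@measurable_funD _ _ _ _ fst (cst (a 0 0))).
      exact: measurable_fst.
    exact: measurable_cst.
  apply: measurable_rV_of_coord => i.
  have -> : (fun p : measurableTypeR R * 'rV[R]_n =>
      (p.2 + rsubmx (a : 'rV_(1 + n))) 0 i : measurableTypeR R) =
      ((fun p : measurableTypeR R * 'rV[R]_n => p.2 0 i) \+ cst (rsubmx (a : 'rV_(1 + n)) 0 i)).
    by apply/funext => p; rewrite mxE.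
  apply: measurable_funD; last exact: measurable_cst.
  by apply: (measurableT_comp (measurable_coord i)); exact: measurable_snd.
rewrite /= /lebesgue_rV_step /pushforward.
have -> : row_cons @^-1` ((fun v => v + a) @^-1` A) =
          T @^-1` (row_cons @^-1` A).
  suff E p : row_cons p + a = row_cons (T p).
    by apply/seteqP; split => p /=; rewrite E.
  rewrite -[LHS]row_unconsK; congr row_cons.
  rewrite /row_uncons mxE row_cons0; congr pair.
  by apply/rowP => i; rewrite [LHS]mxE [LHS]mxE row_consS !mxE.
have mB : measurable (row_cons @^-1` A).
  by apply: measurable_preim => //; exact: measurable_row_cons.
apply/esym/(product_measure_unique
  (m' := pushforward (@lebesgue_measure R \x lebesgue_rV n)%E T)) => //.
move=> X Y mX mY.
transitivity ((@lebesgue_measure R \x lebesgue_rV n)%E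
  (((fun x => x + a 0 0) @^-1` X) `*`
  ((fun v => v + rsubmx (a : 'rV_(1 + n))) @^-1` Y))); first by [].
rewrite product_measure1E//.
- by congr (_ * _)%E; [exact: lebesgue_measure_shift|exact: IH].
- by apply: measurable_preim => //; apply: measurable_funD.
- by apply: measurable_preim => //; exact: measurable_shift.
Qed.

#[local] Opaque lebesgue_rV.

Lemma fubini_sections d1 d2 (T1 : measurableType d1) (T2 : measurableType d2)
  (m1 : {sigma_finite_measure set T1 -> \bar R})
  (m2 : {sigma_finite_measure set T2 -> \bar R}) (S : set (T1 * T2)) :
  measurable S ->
  (\int[m1]_x m2 [set y | S (x, y)] = \int[m2]_y m1 [set x | S (x, y)])%E.
Proof.
move=> mS; have := indic_fubini_tonelli m1 m2 mS.
rewrite indic_fubini_tonelli_FE// indic_fubini_tonelli_GE//= => H.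
transitivity (\int[m1]_x (m2 \o xsection S) x)%E.
  by apply: eq_integral => x _ /=; rewrite xsectionE.
by rewrite H; apply: eq_integral => y _ /=; rewrite ysectionE.
Qed.

Lemma enorm_coord n (x : 'rV[R]_n) i : `|x 0 i| <= enorm x.
Proof.
rewrite -sqrtr_sqr ler_wsqrtr// (bigD1 i)//= lerDl.
by apply: sumr_ge0 => j _; exact: sqr_ge0.
Qed.

Lemma enorm_ge0 n (x : 'rV[R]_n) : 0 <= enorm x.
Proof. exact: sqrtr_ge0. Qed.

Lemma enorm_sqr n (x : 'rV[R]_n) : enorm x ^+ 2 = \sum_i x 0 i ^+ 2.
Proof. by rewrite sqr_sqrtr// sumr_ge0// => i _; exact: sqr_ge0. Qed.

Lemma enorm_eq0 n (x : 'rV[R]_n) : (enorm x == 0) = (x == 0).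
Proof.
apply/eqP/eqP => [x0|->].
  by apply/rowP => i; rewrite mxE; apply/eqP; rewrite -normr_le0 -x0 enorm_coord.
by rewrite /enorm big1 ?sqrtr0// => i _; rewrite mxE expr0n.
Qed.

Lemma enorm0 n : enorm (0 : 'rV[R]_n) = 0.
Proof. by apply/eqP; rewrite enorm_eq0. Qed.

Lemma enorm_gt0 n (x : 'rV[R]_n) : (0 < enorm x) = (x != 0).
Proof. by rewrite lt_def enorm_ge0 andbT enorm_eq0. Qed.

Lemma enorm_le n (x y : 'rV[R]_n) :
  (forall i, `|x 0 i| <= `|y 0 i|) -> enorm x <= enorm y.
Proof.
move=> xy; apply: ler_wsqrtr; apply: ler_sum => i _.
by rewrite -(real_normK (num_real (x 0 i))) -(real_normK (num_real (y 0 i))) lerXn2r ?nnegrE.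
Qed.

Lemma enormZ n (k : R) (x : 'rV[R]_n) : enorm (k *: x) = `|k| * enorm x.
Proof.
rewrite /enorm -sqrtr_sqr -sqrtrM ?sqr_ge0//; congr Num.sqrt.
by rewrite mulr_sumr; apply: eq_bigr => i _; rewrite mxE exprMn.
Qed.

Lemma enormN n (x : 'rV[R]_n) : enorm (- x) = enorm x.
Proof. by rewrite -scaleN1r enormZ normrN1 mul1r. Qed.

(** The constant [n] is far from optimal; only orders of magnitude matter in
    the estimates below. *)
Lemma enorm_le_max n (x : 'rV[R]_n) (M : R) :
  (forall i, `|x 0 i| <= M) -> enorm x <= n%:R * M.
Proof.
case: n x => [|n] x xM; first by rewrite /enorm big_ord0 sqrtr0 mul0r.
have M0 : 0 <= M by exact: le_trans (xM 0).
rewrite -(@ler_pXn2r _ 2)// ?nnegrE ?enorm_ge0 ?mulr_ge0// enorm_sqr exprMn.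
have : \sum_i x 0 i ^+ 2 <= \sum_(i < n.+1) M ^+ 2.
  apply: ler_sum => i _; rewrite -(real_normK (num_real (x 0 i))).
  by rewrite lerXn2r ?nnegrE.
move=> /le_trans; apply; rewrite sumr_const card_ord -[leLHS]mulr_natl.
apply: ler_wpM2r; first exact: sqr_ge0.
by rewrite -natrX ler_nat -[leqLHS]expn1 leq_pexp2l.
Qed.

Lemma measurable_enorm n :
  measurable_fun [set: 'rV[R]_n] (@enorm R n : _ -> measurableTypeR R).
Proof.
apply: (measurableT_comp
  (continuous_measurable_fun (@sqrt_continuous R) :
   measurable_fun setT (Num.sqrt : measurableTypeR R -> measurableTypeR R))).
apply: measurable_sum => i; apply: measurable_funX; exact: measurable_coord.
Qed.

Definition eball n (r : R) : set 'rV[R]_n := [set x | enorm x <= r].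

Lemma measurable_eball n r : measurable (@eball n r).
Proof.
have -> : @eball n r = @enorm R n @^-1` `]-oo, r].
  by apply/seteqP; split => x; rewrite /eball /= in_itv.
by apply: measurable_preim => //; exact: measurable_enorm.
Qed.

(** The first coordinate is singled out because the boxes below are translated
    along the first axis. Half-open sides make adjacent boxes disjoint. *)
Definition box n (a b l u : R) : set 'rV[R]_n.+1 :=
  [set v | forall i, (if i == 0 then `[a, b[ else `[l, u[)%classic (v 0 i)].

Lemma measurable_box_itv n a b l u : measurable (@box n a b l u).
Proof.
by apply: (@measurable_box _ _
  (fun i => if i == 0 then `[a, b[ else `[l, u[)%classic) => i; case: ifP.
Qed.

Lemma box_volume n a b l u : a <= b -> l <= u ->
  lebesgue_rV n.+1 (@box n a b l u) = ((b - a) * (u - l) ^+ n)%:E.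
Proof.
move=> ab lu; rewrite (@lebesgue_rV_box _ _
  (fun i => if i == 0 then `[a, b[ else `[l, u[)%classic); last first.
  by move=> i; case: ifP.
have itvE (x y : R) : x <= y ->
    lebesgue_measure (`[x, y[%classic : set (measurableTypeR R)) = (y - x)%:E.
  move=> xy; rewrite lebesgue_measure_itv/= lte_fin; case: ltP => // yx.
  by have -> : y = x by [apply/eqP; rewrite eq_le xy yx]; rewrite subrr.
rewrite big_ord_recl/= itvE// EFinM; congr (_ * _)%E.
under eq_bigr do rewrite itvE//.
by rewrite prodEFin prodr_const card_ord.
Qed.

End lebesgue_rV_invariance.

(** * Reflections *)

Section reflection.
Context {R : realType} {n : nat}.
Implicit Types w x y z : 'rV[R]_n.+1.

Definition dot w z : R := \sum_i w 0 i * z 0 i.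

(** Householder reflection in the hyperplane orthogonal to [w]; division by
    zero makes it the identity when [w = 0]. *)
Definition refl w z := z - (2 * dot w z / dot w w) *: w.

Lemma dotDr w x y : dot w (x + y) = dot w x + dot w y.
Proof. by rewrite -big_split; apply: eq_bigr => i _; rewrite mxE mulrDr. Qed.

Lemma dotZr w k x : dot w (k *: x) = k * dot w x.
Proof. by rewrite mulr_sumr; apply: eq_bigr => i _; rewrite mxE mulrCA. Qed.

Lemma dotC w x : dot w x = dot x w.
Proof. by apply: eq_bigr => i _; rewrite mulrC. Qed.

Lemma dotxx x : dot x x = enorm x ^+ 2.
Proof. by rewrite enorm_sqr; apply: eq_bigr => i _; rewrite expr2. Qed.

Lemma reflD w x y : refl w (x + y) = refl w x + refl w y.
Proof. by rewrite /refl dotDr mulrDr mulrDl scalerDl opprD addrACA. Qed.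

Lemma reflZ w k x : refl w (k *: x) = k *: refl w x.
Proof.
rewrite /refl dotZr scalerBr; congr (_ - _); rewrite scalerA; congr (_ *: _).
by ring.
Qed.

Lemma reflB w x y : refl w (x - y) = refl w x - refl w y.
Proof. by rewrite reflD -[- y]scaleN1r reflZ scaleN1r. Qed.

Lemma enorm_refl w z : enorm (refl w z) = enorm z.
Proof.
have [->|w0] := eqVneq w 0; first by rewrite /refl scaler0 subr0.
have ww : dot w w != 0 by rewrite dotxx expf_neq0// enorm_eq0.
apply/eqP; rewrite -(@eqrXn2 _ 2)// ?enorm_ge0// -!dotxx; apply/eqP.
rewrite /refl; set t := 2 * _ / _.
have dB u : dot u (z - t *: w) = dot u z - t * dot u w.
  by rewrite dotDr -scaleNr dotZr mulNr.
by rewrite dB [dot _ z]dotC [dot _ w]dotC !dB [dot z w]dotC /t; field.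
Qed.

Lemma reflK w : involutive (refl w).
Proof.
move=> z; have [->|w0] := eqVneq w 0; first by rewrite /refl !scaler0 !subr0.
have ww : dot w w != 0 by rewrite dotxx expf_neq0// enorm_eq0.
rewrite /refl; set t := 2 * dot w z / _.
have -> : dot w (z - t *: w) = dot w z - t * dot w w.
  by rewrite dotDr -scaleNr dotZr mulNr.
rewrite -addrA -opprD -scalerDl.
suff -> : t + 2 * (dot w z - t * dot w w) / dot w w = 0.
  by rewrite scale0r subr0.
by rewrite /t; field.
Qed.

Lemma refl0 w : refl w 0 = 0.
Proof. by rewrite -[in LHS](scale0r 0) reflZ scale0r. Qed.

Lemma refl_eq0 w z : (refl w z == 0) = (z == 0).
Proof. by rewrite -!enorm_eq0 enorm_refl. Qed.

(** Any point can be moved to the first axis by such a reflection, which is how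
    statements about a general position are reduced to the axis. *)
Lemma refl_swap x y : enorm x = enorm y -> refl (x - y) y = x.
Proof.
move=> xy; have [->|x0] := eqVneq x y; first by rewrite /refl subrr scaler0 subr0.
rewrite /refl; set w := x - y.
have ww : dot w w != 0 by rewrite dotxx expf_neq0// enorm_eq0 subr_eq0.
have xx : dot x x = dot y y by rewrite !dotxx xy.
have E u v : dot (u - v) (u - v) = dot u u - 2 * dot u v + dot v v.
  rewrite -scaleN1r dotDr dotZr dotC dotDr dotZr [dot (u + _) v]dotC dotDr dotZr.
  by rewrite [dot v u]dotC; ring.
have wyE : dot w y = dot x y - dot y y.
  by rewrite dotC dotDr -scaleN1r dotZr [dot y x]dotC; ring.
have -> : 2 * dot w y / dot w w = -1.
  have H : 2 * dot w y = - dot w w by rewrite wyE /w E xx; ring.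
  by rewrite H mulNr divff.
by rewrite scaleN1r opprK /w addrC subrK.
Qed.

Lemma refl_coord w z i : refl w z 0 i = z 0 i - 2 * dot w z / dot w w * w 0 i.
Proof. by rewrite !mxE. Qed.

Lemma measurable_dot w :
  measurable_fun setT (dot w : 'rV[R]_n.+1 -> measurableTypeR R).
Proof.
have -> : (dot w : 'rV[R]_n.+1 -> measurableTypeR R) =
    (fun z => \sum_(i <- index_enum 'I_n.+1) w 0 i * z 0 i) by [].
apply: measurable_sum => i.
by apply: measurable_funM; [exact: measurable_cst|exact: measurable_coord].
Qed.

Lemma measurable_refl w : measurable_fun setT (refl w).
Proof.
apply: measurable_rV_of_coord => i.
have -> : (fun t => refl w t 0 i : measurableTypeR R) =
    (fun z => z 0 i - 2 * dot w z / dot w w * w 0 i).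
  by apply/funext => z; exact: refl_coord.
apply: measurable_funB; first exact: measurable_coord.
apply: measurable_funM; last exact: measurable_cst.
apply: measurable_funM; last exact: measurable_cst.
by apply: measurable_funM; [exact: measurable_cst|exact: measurable_dot].
Qed.

Lemma lebesgue_eball1 :
  (0 < lebesgue_rV n.+1 (@eball R n.+1 1) < +oo)%E.
Proof.
have n0 : 0 < n.+1%:R :> R by rewrite ltr0n.
apply/andP; split.
  apply: (@lt_le_trans _ _ (lebesgue_rV n.+1 (@box R n 0 n.+1%:R^-1 0 n.+1%:R^-1))).
    by rewrite box_volume ?invr_ge0 ?ltW// lte_fin subr0 mulr_gt0 ?exprn_gt0 ?invr_gt0.
  apply: le_measure; rewrite ?inE.
  - exact: measurable_box_itv.
  - exact: measurable_eball.
  - move=> v bv; rewrite /eball /=.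
    have <- : n.+1%:R * n.+1%:R^-1 = 1 :> R by rewrite divff ?gt_eqF.
    apply: enorm_le_max => i; have := bv i.
    by case: ifP => _; rewrite /= in_itv/= => /andP[a b]; rewrite ger0_norm// ltW.
apply: (@le_lt_trans _ _ (lebesgue_rV n.+1 (@box R n (-1) 2 (-1) 2))); last first.
  by rewrite box_volume ?ltry//; lra.
apply: le_measure; rewrite ?inE.
- exact: measurable_eball.
- exact: measurable_box_itv.
- move=> v; rewrite /eball /= => v1 i.
  have := le_trans (enorm_coord v i) v1; rewrite ler_norml => /andP[a b].
  by case: ifP => _; rewrite /= in_itv/=; lra.
Qed.

(** Lebesgue measure is invariant under reflections. By Fubini and
    translation invariance the volume of
    [{(x, y) | |x| <= 1, refl x + y \in A}] is, integrating in [y] first,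
    [vol B * vol A], and, substituting [x - refl y] for [x] and integrating
    in [y] first again, [vol B * vol (refl^-1 A)]. *)
Lemma lebesgue_rV_refl w A : measurable A ->
  lebesgue_rV n.+1 (refl w @^-1` A) = lebesgue_rV n.+1 A.
Proof.
move=> mA; set mu := lebesgue_rV n.+1; set B := @eball R n.+1 1.
have mB : measurable B by exact: measurable_eball.
have mf : measurable_fun setT (refl w) by exact: measurable_refl.
have mfA : measurable (refl w @^-1` A) by exact: measurable_preim.
have m1 : measurable_fun setT (fst : 'rV[R]_n.+1 * 'rV[R]_n.+1 -> _).
  exact: measurable_fst.
have m2 : measurable_fun setT (snd : 'rV[R]_n.+1 * 'rV[R]_n.+1 -> _).
  exact: measurable_snd.
have mD (f g : 'rV[R]_n.+1 * 'rV[R]_n.+1 -> 'rV[R]_n.+1) : measurable_fun setT f ->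
    measurable_fun setT g -> measurable_fun setT (fun p => f p - g p).
  move=> mf' mg; apply: measurable_rV_of_coord => i.
  have -> : (fun t => (f t - g t) 0 i : measurableTypeR R) =
     (fun t => f t 0 i - g t 0 i) by apply/funext => t; rewrite !mxE.
  by apply: measurable_funB; apply: (measurableT_comp (measurable_coord i)).
pose S := [set p : 'rV[R]_n.+1 * 'rV[R]_n.+1 | B p.1 /\ A (p.2 - refl w (- p.1))].
pose S' := [set p : 'rV[R]_n.+1 * 'rV[R]_n.+1 |
             A (refl w p.1) /\ B (p.1 - refl w p.2)].
have reflN x : refl w (- x) = - refl w x by rewrite -scaleN1r reflZ scaleN1r.
have mN : measurable_fun setT (fun x : 'rV[R]_n.+1 => - x).
  apply: measurable_rV_of_coord => i.
  have -> : (fun t : 'rV[R]_n.+1 => (- t) 0 i : measurableTypeR R) =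
     (fun t => - (t 0 i)) by apply/funext => t; rewrite !mxE.
  by apply: measurable_funN; exact: measurable_coord.
have mS : measurable S.
  apply: measurableI; first exact: measurable_preim.
  apply: (@measurable_preim _ _ _ _ (fun p : 'rV[R]_n.+1 * 'rV[R]_n.+1 => p.2 - refl w (- p.1)) A) => //.
  by apply: mD => //; apply: measurableT_comp => //; exact: measurableT_comp.
have mS' : measurable S'.
  apply: measurableI; last first.
    apply: (@measurable_preim _ _ _ _ (fun p : 'rV[R]_n.+1 * 'rV[R]_n.+1 => p.1 - refl w p.2) B) => //.
    by apply: mD => //; exact: measurableT_comp.
  apply: (@measurable_preim _ _ _ _ (fun p : 'rV[R]_n.+1 * 'rV[R]_n.+1 => refl w p.1) A) => //.
  exact: measurableT_comp.
have sh X (a : 'rV[R]_n.+1) : measurable X -> mu [set y | X (y - a)] = mu X.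
  by move=> mX; rewrite -(lebesgue_rV_shift (- a) mX).
have F1 : (\int[mu]_x mu [set y | S (x, y)] = mu A * mu B)%E.
  transitivity (\int[mu]_x (mu A * (\1_B x)%:E))%E.
    apply: eq_integral => x _; rewrite indicE.
    have [xB|xB] := boolP (x \in B).
      rewrite mule1 -(sh A (refl w (- x)))//; congr (mu _).
      by apply/seteqP; split => y; rewrite /S /=; [case|move: xB; rewrite inE].
    rewrite mule0 -(measure0 mu); congr (mu _).
    apply/seteqP; split => y //; rewrite /S /= => -[Bx _].
    by move: xB; rewrite notin_setE.
  rewrite ge0_integralZl//.
  - by rewrite integral_indic// setIT.
  - by apply/measurable_EFinP; exact: measurable_indic.
have F2 : (\int[mu]_x mu [set y | S' (x, y)] = mu (refl w @^-1` A) * mu B)%E.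
  transitivity (\int[mu]_x (mu B * (\1_(refl w @^-1` A) x)%:E))%E; last first.
    rewrite ge0_integralZl//.
    - by rewrite integral_indic// setIT muleC.
    - by apply/measurable_EFinP; exact: measurable_indic.
  apply: eq_integral => x _; rewrite indicE.
  have [xA|xA] := boolP (x \in refl w @^-1` A).
    rewrite mule1 -(sh B (refl w x))//; congr (mu _).
    have E y : enorm (y - refl w x) = enorm (x - refl w y).
      by rewrite -enormN opprB -(enorm_refl w) reflB reflK.
    apply/seteqP; split => y; rewrite /S' /B /eball /= E; first by case.
    by move: xA; rewrite inE.
  rewrite mule0 -(measure0 mu); congr (mu _).
  apply/seteqP; split => y //; rewrite /S' /= => -[Bx _].
  by move: xA; rewrite notin_setE.
have F : (mu A * mu B = mu (refl w @^-1` A) * mu B)%E.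
  rewrite -F1 -F2 (fubini_sections _ _ mS) (fubini_sections _ _ mS').
  apply: eq_integral => y _.
  rewrite -(sh [set x | S (x, y)] (refl w y)); last first.
    have := measurable_ysection y mS; rewrite ysectionE.
    by [].
  congr (mu _); apply/seteqP; split => x; rewrite /S /S' /= reflN opprK reflB reflK subrKC;
    by case.
have /andP[B0 Boo] := lebesgue_eball1.
have Bf : mu B \is a fin_num by rewrite ge0_fin_numE.
have fB0 : 0 < fine (mu B) by rewrite fine_gt0// B0 Boo.
have inv : (mu B * ((fine (mu B))^-1)%:E = 1)%E.
  by rewrite -{1}(fineK Bf) -EFinM divff ?gt_eqF.
by rewrite -[LHS]mule1 -[RHS]mule1 -inv !muleA F.
Qed.

End reflection.

(** * Radially decreasing measures *)

Lemma integral_invariant d (T : measurableType d) (R : realType)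
    (mu : {measure set T -> \bar R}) (F : T -> T) (A : set T) (f : T -> \bar R) :
  measurable_fun setT F ->
  (forall S, measurable S -> mu (F @^-1` S) = mu S) ->
  measurable A -> measurable_fun A f -> (forall x, (0 <= f x)%E) ->
  (\int[mu]_(x in F @^-1` A) f (F x) = \int[mu]_(x in A) f x)%E.
Proof.
move=> mF inv mA mf f0; rewrite -(ge0_integral_pushforward mF)//.
by apply: eq_measure_integral => S mS _; exact: inv.
Qed.

Lemma ge0_le_measure_integral_in d (T : measurableType d) (R : realType)
    (m1 m2 : {measure set T -> \bar R}) (H : set T) (f : T -> \bar R) :
  measurable H -> measurable_fun setT f -> (forall x, (0 <= f x)%E) ->
  (forall S, measurable S -> S `<=` H -> (m1 S <= m2 S)%E) ->
  (\int[m1]_(x in H) f x <= \int[m2]_(x in H) f x)%E.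
Proof.
move=> mH mf f0 m12.
have E (mu : {measure set T -> \bar R}) :
    (\int[mu]_(x in H) f x = \int[mrestr mu mH]_(x in H) f x)%E.
  by apply: eq_measure_integral => S mS SH; rewrite /= /mrestr setIidl.
rewrite (E m1) (E m2); apply: ge0_le_measure_integral => // S mS.
by apply: m12; [exact: measurableI|move=> x []].
Qed.

Section axis.
Context {R : realType} {n : nat}.
Implicit Types r : R.

Definition axis r : 'rV[R]_n.+1 := r *: delta_mx 0 0.

Lemma axisE r i : axis r 0 i = if i == 0 then r else 0.
Proof. by rewrite !mxE eqxx /=; case: eqP => _; rewrite ?mulr1 ?mulr0. Qed.

Lemma enorm_axis r : enorm (axis r) = `|r|.
Proof.
rewrite /enorm big_ord_recl big1 => [|i _]; rewrite axisE/=; last by rewrite expr0n.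
by rewrite addr0 sqrtr_sqr.
Qed.

Lemma axis_neq0 r : 0 < r -> axis r != 0.
Proof. by move=> r0; rewrite -enorm_gt0 enorm_axis gtr0_norm. Qed.

Lemma lebesgue_rV_set1 (x : 'rV[R]_n.+1) : lebesgue_rV n.+1 [set x] = 0%E.
Proof.
have -> : [set x] = [set v : 'rV[R]_n.+1 | forall i, [set x 0 i] (v 0 i)].
  apply/seteqP; split => v /=; first by move=> ->.
  by move=> vx; apply/rowP => i; exact: vx.
rewrite (@lebesgue_rV_box _ _ (fun i => [set x 0 i])); last by move=> i; exact: measurable_set1.
by rewrite big_ord_recl lebesgue_measure_set1 mul0e.
Qed.

End axis.

Section PRD_measures.
Context {R : realType} {n : nat}.
Variables (rho : probability 'rV[R]_n.+1 R) (m : R) (g : 'rV[R]_n.+1 -> R)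
  (phi : R -> R).
Hypotheses (m0 : 0 <= m)
  (gint : (lebesgue_rV n.+1).-integrable [set: 'rV[R]_n.+1] (fun x => (g x)%:E))
  (g0 : forall x, 0 <= g x)
  (phi_dec : forall r s, 0 < r -> r <= s -> phi s <= phi r)
  (gphi : forall x, x != 0 -> g x = phi (enorm x))
  (rhoE : forall A, measurable A ->
     rho A = (m%:E * \d_(0%R : 'rV[R]_n.+1) A
              + \int[lebesgue_rV n.+1]_(x in A) (g x)%:E)%E).

Let mg : measurable_fun setT (EFin \o g).
Proof. exact: measurable_int gint. Qed.

Lemma profile_ge0 s : 0 < s -> 0 <= phi s.
Proof.
move=> s0; have := g0 (axis s); rewrite gphi ?axis_neq0//.
by rewrite enorm_axis gtr0_norm.
Qed.

(** The Dirac mass sits at a fixed point, and both the density and Lebesgue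
    measure are invariant under reflections. *)
Lemma PRD_refl w A : measurable A -> rho (refl w @^-1` A) = rho A.
Proof.
move=> mA; have mw := @measurable_refl R n w.
rewrite !rhoE//; last exact: measurable_preim.
congr (_ + _)%E.
  congr (_ * _)%E; rewrite !diracE; congr (_ %:R%:E); congr nat_of_bool.
  by apply/idP/idP; rewrite !inE /= refl0.
rewrite -(@integral_invariant _ _ _ (lebesgue_rV n.+1) (refl w) A)//.
- apply: eq_integral => x _ /=; congr EFin.
  have [->|x0] := eqVneq x 0; first by rewrite refl0.
  by rewrite !gphi ?refl_eq0// enorm_refl.
- exact: lebesgue_rV_refl.
- exact: measurable_funTS.
Qed.

Lemma PRD_ge_volume (S : set 'rV[R]_n.+1) (r : R) : measurable S ->
  (forall x, S x -> x != 0 /\ enorm x <= r) ->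
  ((phi r)%:E * lebesgue_rV n.+1 S <= rho S)%E.
Proof.
move=> mS Sr; rewrite rhoE//.
apply: (@le_trans _ _ (\int[lebesgue_rV n.+1]_(x in S) (g x)%:E)%E); last first.
  by rewrite leeDr// mule_ge0// lee_fin.
have [->|/set0P[x0 Sx0]] := eqVneq S set0.
  by rewrite measure0 mule0 integral_set0.
have x0P := Sr _ Sx0.
have r0 : 0 < r by rewrite (lt_le_trans _ x0P.2)// enorm_gt0 x0P.1.
rewrite -integral_cst//; apply: ge0_le_integral => //.
- by move=> x _; rewrite lee_fin profile_ge0.
- exact: measurable_funTS.
- move=> x /Sr[x1 xr]; rewrite lee_fin gphi//.
  by apply: phi_dec => //; rewrite enorm_gt0.
Qed.

Lemma PRD_le_volume (S : set 'rV[R]_n.+1) (r : R) : measurable S -> 0 < r ->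
  (forall x, S x -> r <= enorm x) ->
  (rho S <= (phi r)%:E * lebesgue_rV n.+1 S)%E.
Proof.
move=> mS r0 Sr; rewrite rhoE// diracE memNset ?mule0 ?add0e; last first.
  by move=> /Sr; rewrite enorm0 leNgt r0.
rewrite -integral_cst//; apply: ge0_le_integral => //.
- by move=> x _; rewrite lee_fin.
- exact: measurable_funTS.
- move=> x /Sr xr; rewrite lee_fin gphi; first exact: phi_dec.
  by rewrite -enorm_gt0 (lt_le_trans r0).
Qed.

(** After translation the two densities to compare on [A] are [g (z - axis r)]
    and [g (z + axis r)]; when [z] lies in the half-space, [z - axis r] is the
    closer to the origin of the two points. The single point [z = axis r],
    where the first density is evaluated at the origin and the profile says
    nothing, is negligible. The Dirac mass only contributes to the larger
    side. *)
Lemma PRD_shift_le (A : set 'rV[R]_n.+1) (r : R) : 0 < r -> measurable A ->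
  (forall z, A z -> 0 <= z 0 0) ->
  (rho [set y | A (y - axis r)%R] <= rho [set y | A (y + axis r)%R])%E.
Proof.
move=> r0 mA A0.
have mp a : measurable ((fun y : 'rV[R]_n.+1 => y + a)%R @^-1` A).
  by apply: measurable_preim => //; exact: measurable_shift.
have sh a : (\int[lebesgue_rV n.+1]_(x in (fun y : 'rV[R]_n.+1 => y + a)%R @^-1` A)
     (g x)%:E = \int[lebesgue_rV n.+1]_(z in A) (g (z - a)%R)%:E)%E.
  rewrite -(@integral_invariant _ _ _ (lebesgue_rV n.+1)
    (fun y => y + a) A (fun z => (g (z - a))%:E))//.
  - by apply: eq_integral => x _; rewrite addrK.
  - exact: measurable_shift.
  - exact: lebesgue_rV_shift.
  - apply: measurable_funTS.
    by apply: (measurableT_comp mg); exact: measurable_shift.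
  - by move=> x; rewrite lee_fin.
have -> : rho [set y | A (y - axis r)%R] = _ := rhoE (mp (- axis r)).
rewrite diracE memNset ?mule0 ?add0e; last first.
  by move=> /A0; rewrite add0r mxE axisE/= oppr_ge0 leNgt r0.
have -> : rho [set y | A (y + axis r)%R] = _ := rhoE (mp (axis r)).
apply: (@le_trans _ _ (\int[lebesgue_rV n.+1]_(x in [set y | A (y + axis r)%R]) (g x)%:E)%E); last first.
  by rewrite leeDr// mule_ge0// lee_fin.
rewrite (sh (- axis r)) (sh (axis r)) opprK.
apply: ae_ge0_le_integral => //.
- by move=> x _; rewrite lee_fin.
- apply: measurable_funTS.
  by apply: (measurableT_comp mg); exact: measurable_shift.
- by move=> x _; rewrite lee_fin.
- apply: measurable_funTS.
  by apply: (measurableT_comp mg); exact: measurable_shift.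
exists [set axis r]; split.
- rewrite (_ : [set axis r] = [set v : 'rV[R]_n.+1 | forall i, [set axis r 0 i] (v 0 i)]).
    by apply: (@measurable_box _ _ (fun i => [set axis r 0 i])) => i; exact: measurable_set1.
  apply/seteqP; split => v /=; first by move=> ->.
  by move=> vx; apply/rowP => i; exact: vx.
- exact: lebesgue_rV_set1.
- move=> z /= H; apply: contrapT => zr; apply: H => Az; rewrite lee_fin.
  have z0 := A0 _ Az.
  have zm : z - axis r != 0 by rewrite subr_eq0; apply/eqP.
  have lezr : enorm (z - axis r) <= enorm (z + axis r).
    apply: enorm_le => i; rewrite !mxE; case: (i =P 0) => [->|/eqP i0].
      rewrite eqxx mulr1 [leRHS]ger0_norm; last by rewrite addr_ge0// ltW.
      by rewrite ler_norml; lra.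
    by rewrite andbF mulr0 subr0 addr0.
  have zp : z + axis r != 0.
    by rewrite -enorm_gt0 (lt_le_trans _ lezr)// enorm_gt0.
  by rewrite !gphi//; apply: phi_dec => //; rewrite enorm_gt0.
Qed.

(** This positivity is what replaces an explicit computation of the field of a
    sphere: it lets one discard any part of the kernel. *)
Lemma PRD_integral_shift_le (r : R) (f : 'rV[R]_n.+1 -> \bar R) : 0 < r ->
  measurable_fun setT f -> (forall z, (0 <= f z)%E) ->
  (forall z : 'rV[R]_n.+1, z 0 0 < 0 -> f z = 0%E) ->
  (\int[rho]_y f (y - axis r)%R <= \int[rho]_y f (y + axis r)%R)%E.
Proof.
move=> r0 mf f0 fneg.
pose H := [set z : 'rV[R]_n.+1 | 0 <= z 0 0].
have mH : measurable H.
  have -> : H = (fun z : 'rV[R]_n.+1 => z 0 0) @^-1` `[0, +oo[.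
    by apply/seteqP; split => z; rewrite /H /= in_itv/= andbT.
  by apply: measurable_preim => //; exact: measurable_coord.
have E a : (\int[rho]_y f (y + a)%R =
    \int[rho]_(y in (fun y => y + a)%R @^-1` H) f (y + a)%R)%E.
  rewrite [RHS]integral_mkcond; apply: eq_integral => z _; rewrite patchE.
  case: ifPn => //; rewrite notin_setE /H /= => /negP.
  by rewrite -ltNge => /fneg.
rewrite !E.
rewrite -(ge0_integral_pushforward (measurable_shift (- axis r)))//; last exact: measurable_funTS.
rewrite -(ge0_integral_pushforward (measurable_shift (axis r)))//; last exact: measurable_funTS.
apply: ge0_le_measure_integral_in => //; try exact: measurable_shift.
by move=> ? ? S mS SH; exact: (PRD_shift_le r0 mS SH).
Qed.

End PRD_measures.

(** The properties of a measure of [PRD] that the velocity estimate uses;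
    [phi] is the radial profile of its density. *)
Record radial_spec {R : realType} {n : nat} (rho : probability 'rV[R]_n.+1 R)
    (phi : R -> R) : Prop := RadialSpec {
  radial_profile_ge0 : forall s, 0 < s -> 0 <= phi s;
  radial_refl : forall w (A : set 'rV[R]_n.+1), measurable A ->
    rho (refl w @^-1` A) = rho A;
  radial_ge_volume : forall (S : set 'rV[R]_n.+1) (r : R), measurable S ->
    (forall x, S x -> x != 0 /\ enorm x <= r) ->
    ((phi r)%:E * lebesgue_rV n.+1 S <= rho S)%E;
  radial_le_volume : forall (S : set 'rV[R]_n.+1) (r : R), measurable S ->
    0 < r -> (forall x, S x -> r <= enorm x) ->
    (rho S <= (phi r)%:E * lebesgue_rV n.+1 S)%E;
  radial_integral_shift : forall (r : R) (f : 'rV[R]_n.+1 -> \bar R), 0 < r ->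
    measurable_fun setT f -> (forall z, (0 <= f z)%E) ->
    (forall z : 'rV[R]_n.+1, z 0 0 < 0 -> f z = 0%E) ->
    (\int[rho]_y f (y - axis r)%R <= \int[rho]_y f (y + axis r)%R)%E
}.

Lemma PRD_radial_spec {R : realType} {n : nat}
    (rho : probability 'rV[R]_n.+1 R) : PRD rho ->
  exists phi, radial_spec rho phi.
Proof.
move=> [m [g [m0 gint g0 [phi [phi_dec gphi]] rhoE]]]; exists phi; split.
- by move=> s; exact: (profile_ge0 g0 gphi).
- by move=> w A; exact: (PRD_refl gint g0 gphi rhoE).
- by move=> S r; exact: (PRD_ge_volume m0 gint g0 phi_dec gphi rhoE).
- by move=> S r; exact: (PRD_le_volume gint g0 phi_dec gphi rhoE).
- by move=> r f; exact: (PRD_integral_shift_le m0 gint g0 phi_dec gphi rhoE).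
Qed.

(** * Integrable singularities *)

Section powR_lemmas.
Context {R : realType}.
Implicit Types a b q : R.

Lemma powRX a q (j : nat) : 0 <= a -> (a ^+ j) `^ q = (a `^ q) ^+ j.
Proof.
by move=> a0; rewrite -(powR_mulrn j a0) powRAC powR_mulrn ?powR_ge0.
Qed.

Lemma powR_lt1 a q : 0 <= a < 1 -> 0 < q -> a `^ q < 1.
Proof.
move=> /andP[a0 a1] q0; have <- : 1 `^ q = 1 by rewrite powR1.
by apply: gt0_ltr_powR; rewrite ?nnegrE.
Qed.

Lemma le0_powR_anti a b q : q <= 0 -> 0 < a -> a <= b -> b `^ q <= a `^ q.
Proof.
move=> q0 a0 ab; have b0 : 0 < b by exact: lt_le_trans ab.
have E x : x `^ q = (x `^ (- q))^-1 by rewrite -powRN opprK.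
rewrite (E a) (E b) lef_pV2 ?posrE ?powR_gt0//.
by apply: ge0_ler_powR; rewrite ?nnegrE ?oppr_ge0// ltW.
Qed.

End powR_lemmas.

Section singular_integral.
Context d (T : measurableType d) {R : realType}
  (mu : {measure set T -> \bar R}) (N : T -> R).
Hypotheses (mN : measurable_fun setT N) (N0 : forall x, 0 <= N x).

Let mball t : measurable [set x | N x <= t].
Proof.
have -> : [set x | N x <= t] = N @^-1` `]-oo, t].
  by apply/seteqP; split => x /=; rewrite in_itv.
exact: measurable_preim.
Qed.

(** On the dyadic shell [s / 2 ^ (j + 1) < N <= s / 2 ^ j] the integrand is of
    the order of [2 ^ (- j (q + 1))] and the mass at most of the order of
    [2 ^ (- j k)], so the integral is bounded by a geometric series. *)
Lemma integral_singularity (s C q : R) (k : nat) : 0 < s -> 0 <= C ->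
  q <= 0 -> 0 < q + 1 + k%:R ->
  (forall t, 0 < t -> t <= s -> (mu [set x | N x <= t]%R <= (C * t ^+ k)%:E)%E) ->
  (\int[mu]_(x in [set x | (N x <= s)%R]) (N x `^ q * N x)%:E < +oo)%E.
Proof.
move=> s0 C0 q0 qk muC.
pose h : R := 2^-1.
have h01 : 0 < h < 1 by rewrite /h invr_gt0 invf_lt1 //; lra.
have /andP[h0 h1] := h01.
pose a j := s * h ^+ j.
have a0 j : 0 < a j by rewrite mulr_gt0// exprn_gt0.
have as_ j : a j <= s by rewrite /a ger_pMr// exprn_ile1// ltW.
pose c j := a j.+1 `^ q * a j.
have c0 j : 0 <= c j by rewrite mulr_ge0// ?powR_ge0// ltW.
pose F j x := ((c j)%:E * (\1_[set x | N x <= a j]%R x)%:E)%E.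
have F0 j x : (0 <= F j x)%E by rewrite mule_ge0// lee_fin.
have mF j : measurable_fun setT (F j).
  by apply: measurable_funeM; apply/measurable_EFinP; exact: measurable_indic.
set D := [set x | N x <= s].
have mD : measurable D by exact: mball.
apply: (@le_lt_trans _ _ (\int[mu]_(x in D) \sum_(j <oo) F j x)%E).
  apply: ge0_le_integral => //.
  - by move=> x _; rewrite lee_fin mulr_ge0// powR_ge0.
  - apply: measurable_funTS; apply/measurable_EFinP; apply: measurable_funM => //.
    exact: (measurableT_comp (measurable_powR q) mN).
  - apply: ge0_emeasurable_sum => [j x _ _|j _]; first exact: F0.
    exact: measurable_funTS.
  move=> x Dx; have [Nx0|Nx0] := eqVneq (N x) 0.
    by rewrite Nx0 mulr0; apply: nneseries_ge0.
  have Nx : 0 < N x by rewrite lt_def Nx0 N0.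
  have exj : exists j, a j.+1 < N x.
    have := @cvg_geometric R s h; rewrite ger0_norm ?ltW// => /(_ h1).
    move/cvgr_lt => /(_ _ Nx)[m _ /(_ m.+1)/= H].
    by exists m; apply: H.
  have [j aj jmin] := ex_minnP exj.
  have Naj : N x <= a j.
    case: j aj jmin => [|j] aj jmin; first by rewrite /a expr0 mulr1.
    by rewrite leNgt; apply/negP => /jmin; rewrite ltnn.
  apply: le_trans (nneseries_lim_ge j.+1 _) => //.
  rewrite big_nat_recr//=; apply: le_trans (leeDr _ _); last by rewrite sume_ge0.
  rewrite /F indicE mem_set// mule1 lee_fin /c.
  apply: ler_pM => //; first exact: powR_ge0.
  by apply: le0_powR_anti => //; exact: ltW.
rewrite integral_nneseries//; last by move=> j; exact: measurable_funTS.
pose b := C * s ^+ k * (s `^ q * h `^ q * s).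
pose z := h `^ q * h ^+ k.+1.
have b0 : 0 <= b by rewrite !mulr_ge0 ?powR_ge0 ?exprn_ge0// ltW.
have z0 : 0 < z by rewrite mulr_gt0 ?powR_gt0 ?exprn_gt0.
have z1 : z < 1.
  have -> : z = h `^ (q + k.+1%:R).
    by rewrite /z powRD ?(gt_eqF h0) ?implybT// powR_mulrn// ltW.
  apply: powR_lt1; first by rewrite h1 ltW.
  by move: qk; rewrite -natr1; lra.
apply: (@le_lt_trans _ _ (b * (1 - z)^-1)%:E); last exact: ltry.
apply: lime_le; first by apply: is_cvg_nneseries => *; exact: integral_ge0.
apply: nearW => m /=.
apply: (@le_trans _ _ (series (geometric b z) m)%:E); last first.
  by rewrite lee_fin geometric_le_lim// ger0_norm// ltW.
rewrite /series/= -sumEFin; apply: lee_sum => j _.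
rewrite ge0_integralZl//; last 2 first.
- by apply: measurable_funTS; apply/measurable_EFinP; exact: measurable_indic.
- by rewrite lee_fin.
rewrite integral_indic//.
apply: (@le_trans _ _ ((c j)%:E * (C * a j ^+ k)%:E)%E).
  apply: lee_wpmul2l; first by rewrite lee_fin.
  apply: le_trans (muC _ (a0 j) (as_ j)).
  by apply: le_measureS; [exact: measurableI|exact: mball|move=> x []].
rewrite -EFinM lee_fin /c /a /b /z.
rewrite powRM ?exprn_ge0 ?(ltW h0) ?(ltW s0)// powRX ?(ltW h0)//.
have -> : (h `^ q * h ^+ k.+1) ^+ j = (h `^ q) ^+ j * (h ^+ j * (h ^+ j) ^+ k).
  by rewrite exprMn exprS exprMn (exprAC h j k).
rewrite exprMn exprS le_eqVlt; apply/orP; left; apply/eqP.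
by rewrite -!mulrA; ring.
Qed.

End singular_integral.

(** * Integrability of the interaction kernel *)

Section field.
Context {R : realType} {n : nat}.
Variables (rho : probability 'rV[R]_n.+1 R) (phi : R -> R) (alpha : R).
Hypotheses (rhoP : radial_spec rho phi) (m2 : finite_second_moment rho)
  (alpha2 : alpha < 2) (alphad : 0 < n.+1%:R + alpha - 2).

Lemma eball_volume_le (t : R) : 0 < t ->
  (lebesgue_rV n.+1 (@eball R n.+1 t) <= ((3 * t) ^+ n.+1)%:E)%E.
Proof.
move=> t0; have -> : (3 * t) ^+ n.+1 = (2 * t - - t) * (2 * t - - t) ^+ n.
  by rewrite exprS; congr (_ * _ ^+ _); ring.
rewrite -box_volume; [|lra|lra].
apply: le_measureS; [exact: measurable_eball|exact: measurable_box_itv|].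
move=> v; rewrite /eball /= => vt i.
have := le_trans (enorm_coord v i) vt; rewrite ler_norml => /andP[a b].
by case: ifP => _; rewrite /= in_itv/=; lra.
Qed.

Lemma enorm_sub (x y : 'rV[R]_n.+1) : enorm (x - y) = enorm (y - x).
Proof. by rewrite -enormN opprB. Qed.

Lemma measurable_subl (x : 'rV[R]_n.+1) :
  measurable_fun [set: 'rV[R]_n.+1] (fun y => x - y).
Proof.
apply: measurable_rV_of_coord => i.
have -> : (fun t : 'rV[R]_n.+1 => (x - t) 0 i : measurableTypeR R) =
    (fun t => x 0 i - t 0 i) by apply/funext => t; rewrite !mxE.
by apply: measurable_funB; [exact: measurable_cst|exact: measurable_coord].
Qed.

Lemma measurable_powR_enorm (q : R) :
  measurable_fun setT (fun z : 'rV[R]_n.+1 => enorm z `^ q).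
Proof. exact: (measurableT_comp (measurable_powR q) (@measurable_enorm R n.+1)). Qed.

Lemma measurable_gradK i :
  measurable_fun setT (fun z : 'rV[R]_n.+1 => gradK alpha z 0 i).
Proof.
have -> : (fun z : 'rV[R]_n.+1 => gradK alpha z 0 i) =
    (fun z => enorm z `^ (alpha - 2) * z 0 i).
  by apply/funext => z; rewrite mxE.
apply: measurable_funM; first exact: measurable_powR_enorm.
exact: measurable_coord.
Qed.

(** Near the point [axis r], away from the origin, the density is bounded by
    [phi (r / 2)], so balls have mass [O (t ^ n.+1)]; the singularity of the
    kernel is then integrable because [alpha - 1 + n.+1 > 0]. *)
Lemma near_field_finite r : 0 < r ->
  (\int[rho]_(y in [set y | (enorm (axis r - y) <= r / 2)%R])
     (enorm (axis r - y) `^ (alpha - 2) * enorm (axis r - y))%:E < +oo)%E.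
Proof.
move=> r0; have s0 : 0 < r / 2 by rewrite divr_gt0.
have mN : measurable_fun setT (fun y : 'rV[R]_n.+1 => enorm (axis r - y)).
  exact: (measurableT_comp (@measurable_enorm R n.+1) (measurable_subl (axis r))).
have q0 : alpha - 2 <= 0 by move: alpha2; lra.
have qk : 0 < alpha - 2 + 1 + n.+1%:R by move: alphad; lra.
apply: (@integral_singularity _ _ _ rho _ mN _ _ (phi (r / 2) * 3 ^+ n.+1) _ n.+1) => //.
- by move=> y; exact: enorm_ge0.
- by rewrite mulr_ge0// (radial_profile_ge0 rhoP).
move=> t t0 ts.
have mS : measurable [set y : 'rV[R]_n.+1 | enorm (axis r - y) <= t].
  have -> : [set y : 'rV[R]_n.+1 | enorm (axis r - y) <= t] =
    (fun y => axis r - y) @^-1` eball t by [].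
  by apply: measurable_preim; [exact: measurable_subl|exact: measurable_eball].
apply: (le_trans (radial_le_volume rhoP mS s0 _)).
  move=> y /= yt; apply: le_trans (enorm_coord y 0).
  have := le_trans (enorm_coord (axis r - y) 0) yt.
  rewrite !mxE/= mulr1 ler_norml => /andP[a b].
  by apply: le_trans (ler_norm _); lra.
have -> : [set y : 'rV[R]_n.+1 | enorm (axis r - y) <= t] =
    (fun y => y + - axis r) @^-1` eball t.
  by apply/seteqP; split => y; rewrite /eball /= enorm_sub.
rewrite lebesgue_rV_shift; last exact: measurable_eball.
apply: (@le_trans _ _ ((phi (r / 2))%:E * ((3 * t) ^+ n.+1)%:E)%E).
  by rewrite lee_wpmul2l ?eball_volume_le// lee_fin (radial_profile_ge0 rhoP).
by rewrite -EFinM lee_fin exprMn mulrA.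
Qed.

(** Away from the singularity the kernel is at most linear, and is dominated by
    the second moment. *)
Lemma integrable_gradK r i : 0 < r ->
  rho.-integrable setT (fun y => (gradK alpha (axis r - y) 0 i)%:E).
Proof.
move=> r0; have s0 : 0 < r / 2 by rewrite divr_gt0.
pose N (y : 'rV[R]_n.+1) := enorm (axis r - y).
have N0 y : 0 <= N y by exact: enorm_ge0.
have mN : measurable_fun setT N.
  exact: (measurableT_comp (@measurable_enorm R n.+1) (measurable_subl (axis r))).
pose F y := N y `^ (alpha - 2) * N y.
have F0 y : 0 <= F y by rewrite mulr_ge0// powR_ge0.
have mF : measurable_fun setT (EFin \o F).
  apply/measurable_EFinP; apply: measurable_funM => //.
  exact: (measurableT_comp (measurable_powR _) mN).
have mG : measurable_fun setT (fun y : 'rV[R]_n.+1 => (gradK alpha (axis r - y) 0 i)%:E).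
  apply/measurable_EFinP.
  exact: (measurableT_comp (measurable_gradK i) (measurable_subl (axis r))).
pose D := [set y | N y <= r / 2].
have mD : measurable D.
  have -> : D = N @^-1` `]-oo, r / 2].
    by apply/seteqP; split => y; rewrite /D /= in_itv.
  exact: measurable_preim.
have i2 : rho.-integrable setT (fun y : 'rV[R]_n.+1 => (enorm y ^+ 2)%:E).
  apply/integrableP; split.
    by apply/measurable_EFinP; apply: measurable_funX; exact: measurable_enorm.
  apply: le_lt_trans m2; apply: ge0_le_integral => //.
  - apply: measurableT_comp => //.
    by apply/measurable_EFinP; apply: measurable_funX; exact: measurable_enorm.
  - by apply/measurable_EFinP; apply: measurable_funX; exact: measurable_enorm.
  - by move=> y _; rewrite gee0_abs// lee_fin sqr_ge0.
pose K := (r / 2) `^ (alpha - 2).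
pose B (y : 'rV[R]_n.+1) := K * (1 + 2 * r ^+ 2) + K * 2 * enorm y ^+ 2.
have iB : rho.-integrable setT (EFin \o B).
  have -> : EFin \o B = cst (K * (1 + 2 * r ^+ 2))%:E
      \+ (fun y : 'rV[R]_n.+1 => (K * 2)%:E * (enorm y ^+ 2)%:E)%E by [].
  apply: integrableD => //; last exact: integrableZl.
  exact: finite_measure_integrable_cst.
apply/integrableP; split => //.
apply: (@le_lt_trans _ _ (\int[rho]_y (F y)%:E)%E).
  apply: ge0_le_integral => //; first exact: measurableT_comp.
  move=> y _; rewrite lee_fin mxE normrM ger0_norm ?powR_ge0//.
  by rewrite ler_wpM2l ?powR_ge0// enorm_coord.
rewrite -(setUv D) (@ge0_integral_setU _ _ _ rho D (~` D) mD (measurableC mD)); last 3 first.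
- by rewrite setUv.
- by move=> y _; rewrite lee_fin.
- exact/disj_setPCl.
rewrite lte_add_pinfty//; first exact: near_field_finite.
apply: (@le_lt_trans _ _ (\int[rho]_y (B y)%:E)%E); last first.
  by apply: integrable_lty iB.
apply: (@le_trans _ _ (\int[rho]_(y in ~` D) (B y)%:E)%E).
  apply: ge0_le_integral => //; first exact: measurableC.
  - by move=> y _; rewrite lee_fin.
  - exact: measurable_funTS.
  - by apply: measurable_funTS; exact: measurable_int iB.
  - move=> y; rewrite /D /= => /negP; rewrite -ltNge => sN.
    rewrite lee_fin /F /B.
    apply: (@le_trans _ _ (K * N y)).
      by rewrite ler_wpM2r// /K le0_powR_anti//; [by move: alpha2; lra|exact: ltW].
    have -> : K * (1 + 2 * r ^+ 2) + K * 2 * enorm y ^+ 2 =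
      K * (1 + 2 * r ^+ 2 + 2 * enorm y ^+ 2) by ring.
    rewrite ler_wpM2l ?powR_ge0//.
    have N2 : N y ^+ 2 <= 2 * r ^+ 2 + 2 * enorm y ^+ 2.
      have -> : r ^+ 2 = enorm (axis r : 'rV[R]_n.+1) ^+ 2.
        by rewrite enorm_axis gtr0_norm.
      rewrite /N !enorm_sqr !mulr_sumr -big_split/=.
      apply: ler_sum => j _; rewrite [X in X ^+ 2]mxE [X in (_ + X) ^+ 2]mxE.
      by have := sqr_ge0 (axis r 0 j + y 0 j); rewrite !expr2; nra.
    by have := sqr_ge0 (N y - 1); rewrite !expr2 in N2 *; nra.
apply: ge0_subset_integral => //; first exact: measurableC.
- exact: measurable_int iB.
- move=> y _; rewrite lee_fin /B -mulrA -mulrDr mulr_ge0 ?powR_ge0//.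
  by have := sqr_ge0 r; have := sqr_ge0 (enorm y); lra.
Qed.

End field.

(** * The velocity field is radial *)

Lemma adde_of_diff (R : realDomainType) (v p q p' q' s : \bar R) :
  v = (p - q)%E -> p = p' -> q = q' -> p' = s -> (0 <= q')%E ->
  (q' < +oo)%E -> (v + q' = s)%E.
Proof.
move=> -> -> -> -> q0 qoo; rewrite subeK//.
by rewrite ge0_fin_numE.
Qed.

Section field_radial.
Context {R : realType} {n : nat}.
Variables (rho : probability 'rV[R]_n.+1 R) (phi : R -> R) (alpha : R).
Hypotheses (rhoP : radial_spec rho phi) (m2 : finite_second_moment rho)
  (alpha2 : alpha < 2) (alphad : 0 < n.+1%:R + alpha - 2).

Let field (x : 'rV[R]_n.+1) : 'rV[R]_n.+1 :=
  rV_integral rho setT (fun y => gradK alpha (x - y)).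

Let field_integrable (x : 'rV[R]_n.+1) := forall i,
  rho.-integrable setT (fun y => (gradK alpha (x - y) 0 i)%:E).

Lemma coordB (x y : 'rV[R]_n.+1) j : (x - y) 0 j = x 0 j - y 0 j.
Proof. by rewrite !mxE. Qed.

Lemma coordD (x y : 'rV[R]_n.+1) j : (x + y) 0 j = x 0 j + y 0 j.
Proof. by rewrite !mxE. Qed.

Lemma gradK_refl w (z : 'rV[R]_n.+1) :
  gradK alpha (refl w z) = refl w (gradK alpha z).
Proof. by rewrite /gradK enorm_refl reflZ. Qed.

(** Both the kernel and the measure commute with reflections, so the field
    does. *)
Lemma field_refl w (x : 'rV[R]_n.+1) : field_integrable x ->
  field (refl w x) = refl w (field x).
Proof.
move=> ix; apply/rowP => i.
have mw : measurable_fun setT (refl w) by exact: measurable_refl.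
have idot : rho.-integrable setT
    (fun y => (dot w (gradK alpha (x - y)))%:E).
  have -> : (fun y => (dot w (gradK alpha (x - y)))%:E) =
    (fun y => \sum_(k <- index_enum 'I_n.+1) (w 0 k)%:E * (gradK alpha (x - y) 0 k)%:E)%E.
    by apply/funext => y; rewrite /dot -sumEFin; apply: eq_bigr => k _; rewrite EFinM.
  by apply: integrable_sum => // k _; exact: integrableZl.
have dotE : \int[rho]_y dot w (gradK alpha (x - y)) = dot w (field x).
  rewrite /Rintegral.
  under eq_integral => y _.
    rewrite /dot -sumEFin; under eq_bigr do rewrite EFinM; over.
  rewrite /= integral_sum//; last by move=> k; exact: integrableZl.
  rewrite -[RHS]/(fine (dot w (field x))%:E) /dot -sumEFin; congr fine.
  apply: eq_bigr => k _; rewrite mxE integralZl// EFinM fineK//.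
  exact: integrable_fin_num.
set t := 2 / dot w w * w 0 i.
have E y : gradK alpha (refl w x - refl w y) 0 i =
    gradK alpha (x - y) 0 i - t * dot w (gradK alpha (x - y)).
  by rewrite -reflB gradK_refl refl_coord /t; congr (_ - _); ring.
have iE : rho.-integrable setT
    (fun y => (gradK alpha (refl w x - refl w y) 0 i)%:E).
  under [X in rho.-integrable _ X]eq_fun do rewrite E EFinB EFinM.
  by apply: integrableB => //; exact: integrableZl.
rewrite refl_coord mxE.
transitivity (\int[rho]_y gradK alpha (refl w x - refl w y) 0 i).
  rewrite /Rintegral; congr fine.
  have mf : measurable_fun setT
      (fun y : 'rV[R]_n.+1 => (gradK alpha (refl w x - y) 0 i)%:E).
    apply/measurable_EFinP.
    exact: (measurableT_comp (measurable_gradK alpha i) (measurable_subl _)).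
  rewrite -(integral_pushforward mw (D := setT) mf)//.
  by apply: eq_measure_integral => S mS _; rewrite /= /pushforward (radial_refl rhoP).
have it : rho.-integrable setT (EFin \o (fun y => t * dot w (gradK alpha (x - y)))).
  exact: (integrableZl measurableT t idot).
transitivity (\int[rho]_y
    (gradK alpha (x - y) 0 i - t * dot w (gradK alpha (x - y)))).
  by apply: eq_Rintegral => y _; exact: E.
rewrite (RintegralB measurableT (ix i) it) (RintegralZl t measurableT idot).
by rewrite [in RHS]mxE dotE /t; congr (_ - _); ring.
Qed.

Lemma field_integrable_axis r : 0 < r -> field_integrable (axis r).
Proof. by move=> r0 i; exact: (integrable_gradK rhoP m2 alpha2 alphad). Qed.

(** On the first axis the field has no transverse component, because the
    measure is invariant under the reflections fixing that axis. *)
Lemma field_axis r : 0 < r -> field (axis r) = axis (field (axis r) 0 0).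
Proof.
move=> r0; apply/rowP => k; rewrite axisE; case: eqP => [->//|/eqP k0].
pose w : 'rV[R]_n.+1 := delta_mx 0 k.
have wE j : w 0 j = (j == k)%:R by rewrite mxE eqxx.
have dotE z : dot w z = z 0 k.
  rewrite /dot (bigD1 k)//= big1 => [|j /negbTE jk]; rewrite wE.
    by rewrite eqxx mul1r addr0.
  by rewrite jk mul0r.
have wr : refl w (axis r) = axis r.
  by rewrite /refl dotE axisE (negbTE k0) mulr0 mul0r scale0r subr0.
have := field_refl w (field_integrable_axis r0).
rewrite wr => /rowP/(_ k); rewrite refl_coord !dotE wE eqxx => H.
have -> : field (axis r) 0 k = 2^-1 * (field (axis r) 0 k -
   (field (axis r) 0 k - 2 * field (axis r) 0 k / 1 * 1)) by field.
by rewrite mulr1n in H; rewrite -H subrr mulr0.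
Qed.

(** Transport the axial case by a reflection sending the first axis to the
    direction of [x]. *)
Lemma field_radial (x : 'rV[R]_n.+1) : x != 0 ->
  field x = (field (axis (enorm x)) 0 0 / enorm x) *: x.
Proof.
rewrite -enorm_gt0 => r0; set r := enorm x.
have xE : refl (x - axis r) (axis r) = x.
  by apply: refl_swap; rewrite enorm_axis gtr0_norm.
rewrite -[in LHS]xE field_refl; last exact: field_integrable_axis.
rewrite {1}field_axis//; set W := field _ _ _.
have -> : axis W = (W / r) *: axis r :> 'rV[R]_n.+1.
  by rewrite scalerA divfK ?gt_eqF.
by rewrite reflZ xE.
Qed.

(** Positive part of the first component of the kernel; the negative part is
    obtained from it by [z |-> - z]. *)
Definition gradK_pos (z : 'rV[R]_n.+1) : R :=
  Num.max (z 0 0) 0 * enorm z `^ (alpha - 2).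

Lemma gradK_pos_ge0 z : 0 <= gradK_pos z.
Proof. by rewrite mulr_ge0 ?powR_ge0// le_max lexx orbT. Qed.

Lemma measurable_gradK_pos : measurable_fun setT gradK_pos.
Proof.
apply: measurable_funM; last exact: measurable_powR_enorm.
by apply: measurable_maxr; [exact: measurable_coord|exact: measurable_cst].
Qed.

(** The two parts of the kernel contribute the integrals of [gradK_pos] over
    the measure translated in opposite directions along the axis; for the
    positive part this uses the symmetry [y_0 |-> - y_0] of the measure. The
    equality is stated additively because it holds in the extended reals. *)
Lemma field_axis_split r : 0 < r ->
  ((field (axis r) 0 0)%:E + \int[rho]_y (gradK_pos (y - axis r)%R)%:E =
   \int[rho]_y (gradK_pos (y + axis r)%R)%:E)%E /\
  (\int[rho]_y (gradK_pos (y - axis r)%R)%:E < +oo)%E.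
Proof.
move=> r0; pose G (y : 'rV[R]_n.+1) := (gradK alpha (axis r - y) 0 0)%:E.
have iG : rho.-integrable setT G by exact: field_integrable_axis.
have posE (y : 'rV[R]_n.+1) : (G^\+ y)%E = (gradK_pos (axis r - y))%:E.
  rewrite funeposE /G /gradK_pos maxr_pMl ?powR_ge0// mul0r -EFin_max.
  by rewrite [in LHS]mxE mulrC.
have negE (y : 'rV[R]_n.+1) : (G^\- y)%E = (gradK_pos (y - axis r))%:E.
  rewrite funenegE /G /gradK_pos maxr_pMl ?powR_ge0// mul0r -EFinN -EFin_max.
  by rewrite [in LHS]mxE enorm_sub -mulrN mulrC !mxE opprB.
have symE : (\int[rho]_y (gradK_pos (axis r - y)%R)%:E =
  \int[rho]_y (gradK_pos (y + axis r)%R)%:E)%E.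
  pose w : 'rV[R]_n.+1 := delta_mx 0 0.
  have wE j : w 0 j = (j == 0)%:R by rewrite mxE eqxx.
  have dotE z : dot w z = z 0 0.
    rewrite /dot (bigD1 0)//= big1 => [|j /negbTE jk]; rewrite wE.
      by rewrite eqxx mul1r addr0.
    by rewrite jk mul0r.
  have symP (y : 'rV[R]_n.+1) :
      gradK_pos (axis r - refl w y) = gradK_pos (y + axis r).
    have zE : (axis r - refl w y) 0 0 = (y + axis r) 0 0.
      have w1 : w 0 0 = 1 by rewrite wE eqxx.
      rewrite coordB refl_coord (coordD y) !dotE w1 axisE eqxx.
      by field.
    have eE : enorm (axis r - refl w y) = enorm (y + axis r).
      rewrite /enorm; congr Num.sqrt; apply: eq_bigr => j _.
      case: (eqVneq j 0) => [->|/negbTE j0]; first by rewrite zE.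
      rewrite coordB refl_coord (coordD y) !wE j0 axisE j0 mulr0n mulr0 subr0 sub0r addr0.
      by rewrite sqrrN.
    by rewrite /gradK_pos zE eE.
  have mf : measurable_fun setT
      (fun y : 'rV[R]_n.+1 => (gradK_pos (axis r - y)%R)%:E).
    apply/measurable_EFinP.
    exact: (measurableT_comp measurable_gradK_pos (measurable_subl _)).
  have II : (\int[rho]_y (gradK_pos (axis r - refl w y)%R)%:E =
             \int[rho]_y (gradK_pos (axis r - y)%R)%:E)%E.
    have := @integral_invariant _ _ _ rho _ _ _ (@measurable_refl R n w)
      (fun S => @radial_refl _ _ _ _ rhoP w S) measurableT (measurable_funTS mf)
      (fun y => gradK_pos_ge0 (axis r - y)).
    by rewrite preimage_setT.
  apply: (eq_trans (esym II)).
  by apply: eq_integral => y _; rewrite symP.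
have Ifin : (\int[rho]_y (gradK_pos (y - axis r)%R)%:E < +oo)%E.
  have : (\int[rho]_y G^\- y < +oo)%E by exact: integral_funeneg_lt_pinfty.
  congr (_ < _)%E; apply: eq_integral => y _.
  exact: negE.
have VE : ((field (axis r) 0 0)%:E = \int[rho]_y G y)%E.
  have iGf := integrable_fin_num measurableT iG.
  rewrite /field /rV_integral.
  rewrite mxE.
  exact: (fineK iGf).
have PE : (\int[rho]_y G^\+ y = \int[rho]_y (gradK_pos (axis r - y)%R)%:E)%E.
  by apply: eq_integral => y _; exact: posE.
have NE : (\int[rho]_y G^\- y = \int[rho]_y (gradK_pos (y - axis r)%R)%:E)%E.
  by apply: eq_integral => y _; exact: negE.
have N0 : (0 <= \int[rho]_y (gradK_pos (y - axis r)%R)%:E)%E.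
  by apply: integral_ge0 => y _; rewrite lee_fin gradK_pos_ge0.
split; last exact: Ifin.
exact: (adde_of_diff (etrans VE (integralE _ _ _)) PE NE symE N0 Ifin).
Qed.

End field_radial.

(** * The velocity controls the mass of boxes *)

Lemma le_add_cancel (R : realType) (w K' K fp fm gp gm : \bar R) :
  (K' = fp + gp -> K = fm + gm -> w + K = K' -> K < +oo -> gm <= gp ->
  0 <= gm -> 0 <= fm -> fp <= w + fm)%E.
Proof.
move=> -> -> E fin gle gm0 fm0.
have gmf : gm \is a fin_num.
  by rewrite ge0_fin_numE//; apply: le_lt_trans fin; rewrite leeDr.
by rewrite -(leeD2rE _ _ gmf) -addeA E leeD2l.
Qed.

Section box_estimates.
Context {R : realType} {n : nat}.
Variables (rho : probability 'rV[R]_n.+1 R) (phi : R -> R) (alpha : R).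
Hypotheses (rhoP : radial_spec rho phi) (m2 : finite_second_moment rho)
  (alpha2 : alpha < 2) (alphad : 0 < n.+1%:R + alpha - 2).

Let W r : R := rV_integral rho setT (fun y => gradK alpha (axis r - y)) 0 0.
Let M (S : set 'rV[R]_n.+1) : R := fine (rho S).

Let MK S : measurable S -> (M S)%:E = rho S.
Proof. by move=> mS; rewrite fineK//; exact: fin_num_measure. Qed.

Let M0 S : 0 <= M S.
Proof. by rewrite fine_ge0. Qed.

Lemma box_shift (a b l u r : R) :
  [set y | @box R n a b l u (y + axis r)] = @box R n (a - r) (b - r) l u.
Proof.
apply/seteqP; split => y H i; have := H i; rewrite coordD axisE;
  by case: ifP => _; rewrite /= !in_itv/=; lra.
Qed.

Let M_box (a b c l u : R) : a <= b -> b <= c ->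
  M (@box R n a c l u) = M (@box R n a b l u) + M (@box R n b c l u).
Proof.
move=> ab bc; apply/eqP; rewrite -eqe EFinD !MK; try exact: measurable_box_itv.
rewrite -measureU; try exact: measurable_box_itv.
  apply/eqP; congr (rho _); apply/seteqP; split => [y H|y [H|H] i].
  - have := H 0; rewrite /= in_itv/= => /andP[y0 y1].
    have [yb|yb] := ltP (y 0 0) b; [left|right] => i; have := H i;
      by case: eqP => [->|//] _; rewrite /= in_itv/= ?yb ?y0 ?y1.
  - have := H i; case: eqP => [->|//] /=; rewrite !in_itv/= => /andP[-> y1] /=.
    exact: lt_le_trans bc.
  - have := H i; case: eqP => [->|//] /=; rewrite !in_itv/= => /andP[y1 ->].
    by rewrite andbT (le_trans ab).
apply/seteqP; split => // y [/(_ 0) + /(_ 0)]; rewrite /= !in_itv/=.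
by move=> /andP[_ y1] /andP[y2 _]; move: y1; rewrite ltNge y2.
Qed.

(** The two translates of a box overlap in their middle part, which cancels:
    only a slab near each end remains. *)
Lemma box_shift_diff (a b l u r : R) : 0 <= r -> a <= b ->
  M [set y | @box R n a b l u (y + axis r)] -
  M [set y | @box R n a b l u (y - axis r)] =
  M (@box R n (a - r) (a + r) l u) - M (@box R n (b - r) (b + r) l u).
Proof.
move=> r0 ab.
have -> : [set y | box a b l u (y - axis r)] = @box R n (a + r) (b + r) l u.
  rewrite -[a + r]/(a + r) -{2}[r]opprK -{3}[r]opprK -box_shift.
  by apply/seteqP; split => y /=; rewrite /axis scaleNr.
rewrite box_shift.
have H1 := @M_box (a - r) (b - r) (b + r) l u.
have H2 := @M_box (a - r) (a + r) (b + r) l u.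
by have := H1; rewrite H2; [move=> E; have := E _ _; lra|lra|lra].
Qed.

(** The remainder [gradK_pos - f] is nonnegative and vanishes outside the
    half-space, so it contributes nonnegatively to the difference of the shifted
    integrals ([radial_integral_shift]) and may be dropped. *)
Lemma field_ge_minorant r (f : 'rV[R]_n.+1 -> R) : 0 < r ->
  measurable_fun setT f -> (forall z, 0 <= f z) ->
  (forall z, f z <= gradK_pos alpha z) ->
  (\int[rho]_y (f (y + axis r)%R)%:E <=
   (W r)%:E + \int[rho]_y (f (y - axis r)%R)%:E)%E.
Proof.
move=> r0 mf f0 fk.
have mk := @measurable_gradK_pos R n alpha.
pose g z := gradK_pos alpha z - f z.
have mg : measurable_fun setT g by exact: measurable_funB.
have g0 z : 0 <= g z by rewrite subr_ge0.
have gneg (z : 'rV[R]_n.+1) : z 0 0 < 0 -> (g z)%:E = 0%E.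
  move=> z0; have k0 : gradK_pos alpha z = 0.
    by rewrite /gradK_pos max_r ?mul0r// ltW.
  by congr EFin; apply/eqP; rewrite eq_le g0 andbT /g k0 sub0r oppr_le0.
have split a : (\int[rho]_y (gradK_pos alpha (y + a)%R)%:E =
    \int[rho]_y (f (y + a)%R)%:E + \int[rho]_y (g (y + a)%R)%:E)%E.
  rewrite -ge0_integralD//.
  - by apply: eq_integral => y _; rewrite -EFinD /g subrKC.
  - by move=> y _; rewrite lee_fin.
  - by apply/measurable_EFinP; exact: (measurableT_comp mf (measurable_shift a)).
  - by move=> y _; rewrite lee_fin.
  - by apply/measurable_EFinP; exact: (measurableT_comp mg (measurable_shift a)).
have [E fin] := field_axis_split rhoP m2 alpha2 alphad r0.
have gle := radial_integral_shift rhoP r0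
  (proj2 (measurable_EFinP _ _) mg) (fun z => g0 z) gneg.
have g0int a : (0 <= \int[rho]_y (g (y + a)%R)%:E)%E.
  by apply: integral_ge0 => y _; rewrite lee_fin.
have f0int a : (0 <= \int[rho]_y (f (y + a)%R)%:E)%E.
  by apply: integral_ge0 => y _; rewrite lee_fin.
exact: (le_add_cancel (split (axis r)) (split (- axis r)) E fin gle
  (g0int _) (f0int _)).
Qed.

Lemma field_axis_ge0 r : 0 < r -> 0 <= W r.
Proof.
move=> r0; have := @field_ge_minorant r (cst 0) r0.
rewrite /= integral0 adde0 lee_fin; apply => //.
by move=> z; exact: gradK_pos_ge0.
Qed.

(** The end slab closer to the origin counts positively, the far one
    negatively. *)
Lemma field_ge_boxes r (s : seq nat) (c a b l u : nat -> R) : 0 < r ->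
  (forall j, 0 <= c j) -> (forall j, a j <= b j) ->
  (forall z, \sum_(j <- s) c j * \1_(@box R n (a j) (b j) (l j) (u j)) z
     <= gradK_pos alpha z) ->
  \sum_(j <- s) c j * (M (@box R n (a j - r) (a j + r) (l j) (u j)) -
                       M (@box R n (b j - r) (b j + r) (l j) (u j))) <= W r.
Proof.
move=> r0 c0 ab ck.
pose A j := @box R n (a j) (b j) (l j) (u j).
have mA j : measurable (A j) by exact: measurable_box_itv.
pose f z := \sum_(j <- s) c j * \1_(A j) z.
have mf : measurable_fun setT f.
  apply: measurable_sum => j; apply: measurable_funM; first exact: measurable_cst.
  exact: measurable_indic.
have f0 z : 0 <= f z by apply: sumr_ge0 => j _; rewrite mulr_ge0.
have intf x : (\int[rho]_y (f (y + x)%R)%:E =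
    (\sum_(j <- s) c j * M [set y | A j (y + x)])%:E)%E.
  rewrite -sumEFin.
  transitivity (\int[rho]_y (\sum_(j <- s) (c j)%:E * (\1_(A j) (y + x)%R)%:E))%E.
    apply: eq_integral => y _; rewrite /f -sumEFin.
    by apply: eq_bigr => j _; rewrite EFinM.
  have mj j : measurable_fun setT (fun y : 'rV[R]_n.+1 => (\1_(A j) (y + x)%R)%:E : \bar R).
    apply/measurable_EFinP.
    exact: (measurableT_comp (@measurable_indic _ _ R setT (A j) (mA j)) (measurable_shift x)).
  rewrite ge0_integral_sum//; last 2 first.
  - by move=> j; exact: measurable_funeM.
  - by move=> j y _; rewrite mule_ge0// lee_fin.
  apply: eq_bigr => j _; rewrite ge0_integralZl//; last by rewrite lee_fin.
  have mS : measurable [set y | A j (y + x)].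
    exact: (measurable_preim (measurable_shift x) (mA j)).
  rewrite EFinM MK//; congr (_ * _)%E.
  transitivity (\int[rho]_y (\1_[set y : 'rV[R]_n.+1 | A j (y + x)%R] y)%:E)%E.
    by apply: eq_integral => y _; rewrite !indicE; congr (_ %:R%:E); apply/idP/idP; rewrite !inE.
  by rewrite integral_indic// setIT.
have := field_ge_minorant r0 mf f0 ck.
rewrite !intf -EFinD lee_fin => H.
rewrite -lerBlDr in H; apply: le_trans H; rewrite -sumrB.
rewrite le_eqVlt; apply/orP; left; apply/eqP; apply: eq_bigr => j _.
by rewrite -mulrBr; congr (_ * _); apply/esym/box_shift_diff => //; exact: ltW.
Qed.

End box_estimates.

(** * Summation over scales *)

(** Summation by parts. The terms [G] enter the second hypothesis as
    [G j - theta * G j.+1] with [theta < 1], so the sum controls each of them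
    up to the boundary term; the recursion then passes from [G] to [E]. *)
Lemma abel_bound (R : realType) (k0 k1 t t' C2 C3 C4 : R) :
  0 < k0 -> 0 < k1 -> 0 <= t -> t < 1 -> 0 <= t' -> t' < 1 ->
  0 <= C2 -> 0 <= C3 -> 0 <= C4 ->
  exists2 C, 0 < C & forall (E G : nat -> R) (w e : R) (N : nat),
    0 <= w -> 0 <= e -> (forall j, 0 <= E j) -> (forall j, 0 <= G j) ->
    k0 * (E 0%N - C4 * G 1%N) <= w ->
    k1 * (\sum_(1 <= j < N.+2) (G j - t * G j.+1)) <= w ->
    G N.+2 <= C2 * e -> G 0%N <= C2 * E 0%N ->
    (forall j, E j.+1 <= t' * E j + C3 * G j) ->
    \sum_(0 <= j < N.+2) E j <= C * (w + e).
Proof.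
move=> k00 k10 t0 t1 t'0 t'1 C20 C30 C40.
pose K1 := (k1^-1 + C2) / (1 - t).
pose K0 := k0^-1 + C4 * K1.
pose K2 := (K0 + C3 * (C2 * K0 + K1)) / (1 - t').
have K10 : 0 < K1 by rewrite divr_gt0 ?subr_gt0// ltr_pwDl ?invr_gt0.
have K00 : 0 < K0 by rewrite ltr_pwDl ?invr_gt0// mulr_ge0// ltW.
have K20 : 0 < K2.
  apply: divr_gt0; last by rewrite subr_gt0.
  apply: ltr_pwDl => //; apply: mulr_ge0 => //; apply: addr_ge0; last exact: ltW.
  by apply: mulr_ge0 => //; exact: ltW.
exists K2 => // E G w e N w0 e0 E0 G0 h0 h1 hb hG0 hE.
pose S := \sum_(1 <= j < N.+2) G j.
have S1 : G 1%N <= S.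
  by rewrite /S big_nat_recl// lerDl sumr_ge0.
have Sshift : \sum_(1 <= j < N.+2) G j.+1 <= S + G N.+2.
  have -> : \sum_(1 <= j < N.+2) G j.+1 = \sum_(2 <= j < N.+3) G j.
    by rewrite [RHS]big_add1.
  have -> : S + G N.+2 = \sum_(1 <= j < N.+3) G j by rewrite big_nat_recr.
  by rewrite [leRHS]big_ltn// lerDr.
have SK : S <= K1 * (w + e).
  move: h1; rewrite sumrB -mulr_sumr -/S => h1.
  have h2 : (1 - t) * S <= (k1^-1 + C2) * (w + e).
    have h3 : S - t * (S + G N.+2) <= k1^-1 * w.
      rewrite [leRHS]mulrC ler_pdivlMr// [leLHS]mulrC; apply: le_trans h1.
      by rewrite ler_pM2l// lerD2l lerN2 ler_wpM2l.
    have h4 : t * G N.+2 <= C2 * e.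
      by apply: le_trans hb; rewrite ler_piMl// ltW.
    have : 0 <= k1^-1 * e by rewrite mulr_ge0// invr_ge0 ltW.
    have : 0 <= C2 * w by rewrite mulr_ge0.
    by lra.
  by rewrite /K1 mulrAC ler_pdivlMr ?subr_gt0// [leLHS]mulrC.
have EK : E 0%N <= K0 * (w + e).
  have h2 : E 0%N <= k0^-1 * w + C4 * S.
    have h3 : E 0%N - C4 * G 1%N <= k0^-1 * w by rewrite [leRHS]mulrC ler_pdivlMr// [leLHS]mulrC.
    have h4 : C4 * G 1%N <= C4 * S by rewrite ler_wpM2l.
    by lra.
  have : C4 * S <= C4 * (K1 * (w + e)) by rewrite ler_wpM2l.
  have : 0 <= k0^-1 * e by rewrite mulr_ge0// invr_ge0 ltW.
  by rewrite /K0; lra.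
pose T := \sum_(0 <= j < N.+2) E j.
have TE : T <= E 0%N + t' * T + C3 * (G 0%N + S).
  have GS : \sum_(0 <= j < N.+1) G j <= G 0%N + S.
    by rewrite big_nat_recl// lerD2l /S big_add1 [leRHS]big_nat_recr//= lerDl.
  have ES : \sum_(0 <= j < N.+1) E j <= T.
    by rewrite /T [leRHS]big_nat_recr//= lerDl.
  rewrite {1}/T big_nat_recl// -addrA lerD2l.
  apply: (@le_trans _ _ (\sum_(0 <= j < N.+1) (t' * E j + C3 * G j))).
    by apply: ler_sum => j _; exact: hE.
  rewrite big_split/= -!mulr_sumr; apply: lerD; exact: ler_wpM2l.
rewrite -/T /K2 mulrAC ler_pdivlMr ?subr_gt0//.
have h1' : C3 * (G 0%N + S) <= C3 * (C2 * (K0 * (w + e)) + K1 * (w + e)).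
  apply: ler_wpM2l => //; apply: lerD => //.
  by apply: le_trans hG0 _; exact: ler_wpM2l.
by lra.
Qed.

Section dyadic_estimates.
Context {R : realType} {n : nat}.
Variables (rho : probability 'rV[R]_n.+2 R) (phi : R -> R) (alpha : R).
Hypotheses (rhoP : radial_spec rho phi) (m2 : finite_second_moment rho)
  (alpha2 : alpha < 2) (alphad : 0 < n.+2%:R + alpha - 2).

Let W r : R := rV_integral rho setT (fun y => gradK alpha (axis r - y)) 0 0.
Let M (S : set 'rV[R]_n.+2) : R := fine (rho S).
Let p (x : R) := x `^ (alpha - 2).
Let d : R := n.+2%:R.
Let B : R := 4 * d.

Let MK S : measurable S -> (M S)%:E = rho S.
Proof. by move=> mS; rewrite fineK//; exact: fin_num_measure. Qed.

Let d2 : 2 <= d. Proof. by rewrite /d ler_nat. Qed.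

Let d0 : 0 < d. Proof. exact: lt_le_trans d2. Qed.

Let alpha2' : alpha - 2 <= 0. Proof. by rewrite subr_le0 ltW. Qed.

Let p_gt0 x : 0 < x -> 0 < p x. Proof. exact: powR_gt0. Qed.

(** A box of side comparable to [r] fits in the ball of radius [r], away from
    the origin, and the density is at least [phi r] there. *)
Lemma profile_le_ball r : 0 < r ->
  r ^+ n.+2 * phi r <= (2 * d) ^+ n.+2 * M (eball r).
Proof.
move=> r0.
pose q := r / (2 * d).
have q0 : 0 < q by rewrite divr_gt0// mulr_gt0.
have rd : q + q = r / d by rewrite /q; field; rewrite gt_eqF.
have qq : q <= q + q by rewrite lerDl ltW.
pose Q := @box R n.+1 q (q + q) q (q + q).
have mQ : measurable Q by exact: measurable_box_itv.
have QP x : Q x -> forall i, 0 < x 0 i /\ `|x 0 i| <= r / d.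
  move=> Qx i; have := Qx i; rewrite -rd.
  by case: ifP => _; rewrite /= in_itv/= => /andP[h1 h2];
    have x0 := lt_le_trans q0 h1; rewrite gtr0_norm// ltW.
have Qball x : Q x -> enorm x <= r.
  move=> /QP xP; have -> : r = n.+2%:R * (r / d).
    by rewrite -/d mulrC divfK// gt_eqF.
  by apply: enorm_le_max => i; exact: (xP i).2.
have H : ((phi r)%:E * lebesgue_rV n.+2 Q <= rho Q)%E.
  apply: (radial_ge_volume rhoP) => // x Qx; split; last exact: Qball.
  by apply: contraTneq (QP _ Qx 0).1 => ->; rewrite mxE ltxx.
have : ((phi r)%:E * lebesgue_rV n.+2 Q <= rho (eball r))%E.
  apply: le_trans H _; apply: le_measureS => //; exact: measurable_eball.
rewrite box_volume// addrK -exprS.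
rewrite -(MK (measurable_eball _)) -EFinM lee_fin.
rewrite /q expr_div_n => H1.
have D0 : 0 < (2 * d) ^+ n.+2 by rewrite exprn_gt0// mulr_gt0.
by move: H1; rewrite mulrA ler_pdivrMr// => H1; rewrite mulrC [leRHS]mulrC.
Qed.

(** In the shell between [r] and [s] the density is at most [phi r]. *)
Lemma ball_le_ball r s : 0 < r -> r <= s ->
  M (eball s) <= M (eball r) + phi r * (3 * s) ^+ n.+2.
Proof.
move=> r0 rs.
have mS : measurable (eball s `\` eball r : set 'rV[R]_n.+2).
  by apply: measurableD; exact: measurable_eball.
have H : (rho (eball s `\` eball r) <= (phi r * (3 * s) ^+ n.+2)%:E)%E.
  apply: (le_trans (radial_le_volume rhoP mS r0 _)).
    by move=> x [_]; rewrite /eball /= => /negP; rewrite -ltNge => /ltW.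
  rewrite EFinM lee_wpmul2l ?lee_fin ?(radial_profile_ge0 rhoP)//.
  apply: (@le_trans _ _ (lebesgue_rV n.+2 (@eball R n.+2 s))).
    by apply: le_measureS => //; exact: measurable_eball.
  by apply: eball_volume_le; exact: lt_le_trans rs.
rewrite -lee_fin EFinD !MK; try exact: measurable_eball.
have U : eball s = eball r `|` (eball s `\` eball r) :> set 'rV[R]_n.+2.
  apply/seteqP; split => x; rewrite /eball /=.
    by have [xr|xr] := lerP (enorm x) r => xs;
      [left|right; split => //; apply/negP; rewrite -ltNge].
  by case=> [xr|[]//]; exact: le_trans rs.
rewrite U measureU//; first exact: leeD2l.
- exact: measurable_eball.
- by rewrite setDIK.
Qed.

Section scales.
Variables (r : R).
Hypothesis r0 : 0 < r.

Let Rj (j : nat) := B ^+ j * (r / 2).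
(* E and G measure, at scale j, the mass and the density respectively *)
Let E j := p (Rj j) * M (eball (Rj j)).
Let G j := p (Rj j) * (Rj j ^+ n.+2 * phi (Rj j)).
Let P := p (2 * d * B).
Let t := (p B * B ^+ n.+2)^-1.

Let B8 : 8 <= B. Proof. by rewrite /B; have := d2; lra. Qed.
Let B0 : 0 < B. Proof. by apply: lt_le_trans B8. Qed.
Let Rj0 j : 0 < Rj j. Proof. by rewrite mulr_gt0 ?exprn_gt0// divr_gt0. Qed.
Let RjS j : Rj j.+1 = B * Rj j. Proof. by rewrite /Rj exprS -mulrA. Qed.

Let t_gt0 : 0 < t.
Proof. by rewrite invr_gt0 mulr_gt0 ?exprn_gt0// p_gt0. Qed.

Let t_lt1 : t < 1.
Proof.
have D0 : 0 < p B * B ^+ n.+2.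
  by apply: mulr_gt0; [exact: p_gt0|exact: exprn_gt0].
rewrite /t invf_lt1//.
have -> : p B * B ^+ n.+2 = expR ((alpha - 2 + n.+2%:R) * ln B).
  have -> : B ^+ n.+2 = B `^ n.+2%:R by rewrite powR_mulrn// ltW.
  rewrite -powRD; last by rewrite (gt_eqF B0) implybT.
  by rewrite /powR (gt_eqF B0).
rewrite expR_gt1 mulr_gt0//; first by move: alphad; lra.
by rewrite ln_gt0//; have := B8; lra.
Qed.

Let pM x y : 0 < x -> 0 < y -> p (x * y) = p x * p y.
Proof. by move=> x0 y0; rewrite /p powRM// ltW. Qed.

Let phi0 s : 0 < s -> 0 <= phi s. Proof. exact: (radial_profile_ge0 rhoP). Qed.

Let tG j : p (Rj j) * (Rj j ^+ n.+2 * phi (Rj j.+1)) = t * G j.+1.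
Proof.
rewrite /G /t RjS (pM B0 (Rj0 j)) (exprMn_comm n.+2 (mulrC B (Rj j))).
have h1 := p_gt0 B0; have h2 : 0 < B ^+ n.+2 by rewrite exprn_gt0.
by field; rewrite !gt_eqF.
Qed.

(** The kernel is at least [a * P * p (Rj j)] on a box at height [a] all of
    whose coordinates are at most [2 * B * Rj j]. *)
Let kernel_on_box j a b l u (z : 'rV[R]_n.+2) : 0 < a ->
  b <= 2 * B * Rj j -> - (2 * B * Rj j) <= l -> u <= 2 * B * Rj j ->
  @box R n.+1 a b l u z -> a * P * p (Rj j) <= gradK_pos alpha z.
Proof.
move=> a0 hb hl hu bz.
have : a <= z 0 0 by have := bz 0; rewrite /= in_itv/= => /andP[].
move=> az; have z0 : 0 < z 0 0 by exact: lt_le_trans az.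
have -> : gradK_pos alpha z = z 0 0 * p (enorm z).
  by rewrite /gradK_pos max_l// ltW.
rewrite -mulrA; apply: ler_pM; [exact: ltW| |exact: az|].
  by apply: mulr_ge0; exact: powR_ge0.
have -> : P * p (Rj j) = p (d * (2 * B * Rj j)).
  rewrite /P -pM//; last by rewrite !mulr_gt0.
  by congr p; ring.
apply: le0_powR_anti => //.
  by apply: (lt_le_trans z0); apply: le_trans (enorm_coord z 0); exact: ler_norm.
apply: enorm_le_max => i; have := bz i; rewrite ler_norml.
have bb : 0 <= 2 * B * Rj j.
  by apply: mulr_ge0; last exact: ltW; apply: mulr_ge0 => //; exact: ltW.
case: (eqVneq i 0) => [->|i0]; rewrite /= in_itv/= => /andP[h1 h2].
  by apply/andP; split; lra.
by apply/andP; split; lra.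
Qed.

(** One box starting at height [r / 2]: its near slab, of thickness [2 r],
    contains the ball of radius [r / 2] around the origin, hence also a possible
    Dirac mass; its far slab lies beyond the next scale, where the density is
    controlled by [G 1]. *)
Lemma inner_estimate :
  (P / 2) * (E 0 - 4 ^+ n.+2 * G 1) <= W r / r.
Proof.
have Rj0E : Rj 0 = r / 2 by rewrite /Rj expr0 mul1r.
have rE : r = 2 * Rj 0 by rewrite Rj0E mulrC divfK.
pose a := Rj 0; pose b := Rj 1 + r; pose u := 2 * Rj 0.
have R1 : 8 * Rj 0 <= Rj 1 by rewrite RjS ler_pM2r.
have R00 := Rj0 0.
pose c := a * P * p (Rj 0).
have c0 : 0 < c by rewrite !mulr_gt0// p_gt0// !mulr_gt0.
have ab : a <= b by rewrite /a /b; lra.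
have := @field_ge_boxes R n.+1 rho phi alpha rhoP m2 alpha2 alphad r [:: 0%N]
  (fun=> c) (fun=> a) (fun=> b) (fun=> - u) (fun=> u) r0 (fun=> ltW c0)
  (fun=> ab).
rewrite big_seq1 -/M -/(W r) => H.
have {H} H : c * (M (box (a - r) (a + r) (- u) u) -
    M (box (b - r) (b + r) (- u) u)) <= W r.
  apply: H => z; rewrite big_seq1 indicE.
  have [zA|_] := boolP (z \in _); last by rewrite mulr0 gradK_pos_ge0.
  rewrite mulr1; apply: kernel_on_box (set_mem zA) => //.
  - by rewrite /b -mulrA -RjS; lra.
  - by rewrite /u -mulrA -RjS; lra.
  - by rewrite /u -mulrA -RjS; lra.
have Hm : M (eball (Rj 0)) <= M (box (a - r) (a + r) (- u) u).
  rewrite -lee_fin !MK; try exact: measurable_eball; try exact: measurable_box_itv.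
  apply: le_measureS; [exact: measurable_eball|exact: measurable_box_itv|].
  move=> z; rewrite /eball /= => zr i.
  have := le_trans (enorm_coord z i) zr; rewrite ler_norml => /andP[h1 h2].
  by case: ifP => _; rewrite /= in_itv/= /a /u; apply/andP; split; lra.
have Hp : M (box (b - r) (b + r) (- u) u) <= phi (Rj 1) * (4 * Rj 0) ^+ n.+2.
  rewrite -lee_fin MK; last exact: measurable_box_itv.
  apply: le_trans (radial_le_volume rhoP (measurable_box_itv _ _ _ _) (Rj0 1) _) _.
    move=> z /(_ 0); rewrite /= in_itv/= /b => /andP[h1 _].
    apply: le_trans (enorm_coord z 0); apply: le_trans (ler_norm _).
    by move: h1; lra.
  rewrite box_volume; [|lra|rewrite /u; lra].
  rewrite -EFinM lee_fin; apply: ler_wpM2l; first exact: phi0.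
  have -> : b + r - (b - r) = 4 * Rj 0 by lra.
  have -> : u - - u = 4 * Rj 0 by rewrite /u; ring.
  by rewrite -exprS.
rewrite ler_pdivlMr//.
have -> : P / 2 * (E 0 - 4 ^+ n.+2 * G 1) * r =
  c * (M (eball (Rj 0)) - 4 ^+ n.+2 * (G 1 / p (Rj 0))).
  rewrite /c /a /E rE.
  by field; rewrite gt_eqF// p_gt0.
apply: le_trans H; rewrite ler_pM2l//; apply: lerB => //.
apply: le_trans Hp _.
have -> : phi (Rj 1) * (4 * Rj 0) ^+ n.+2 =
  4 ^+ n.+2 * (t * G 1 / p (Rj 0)).
  rewrite -tG exprMn; field; by rewrite gt_eqF// p_gt0.
rewrite ler_pM2l ?exprn_gt0// ler_pM2r ?invr_gt0 ?p_gt0//.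
rewrite ler_piMl//.
  by rewrite mulr_ge0 ?powR_ge0// mulr_ge0 ?exprn_ge0 ?phi0 ?ltW.
apply: ltW; exact: t_lt1.
Qed.

Let qj j := Rj j / (2 * d).

Let qjE j : Rj j = 2 * d * qj j.
Proof. by rewrite /qj mulrC divfK// gt_eqF// mulr_gt0. Qed.

Let qj0 j : 0 < qj j. Proof. by rewrite divr_gt0// mulr_gt0. Qed.

Let Rj_le i j : (i <= j)%N -> Rj i <= Rj j.
Proof.
move=> ij; rewrite /Rj ler_pM2r ?divr_gt0// ler_weXn2l//.
by have := B8; lra.
Qed.

Let r_le_qj j : r <= qj j.+1.
Proof.
have h : Rj 1 <= Rj j.+1 by exact: Rj_le.
have d00 := d0; rewrite /qj ler_pdivlMr; last by rewrite mulr_gt0.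
apply: le_trans h; rewrite /Rj expr1 /B le_eqVlt; apply/orP; left; apply/eqP.
by field.
Qed.

(** One box for each scale [j >= 1]. The near slab of box [j] lies within
    radius [Rj j], where the density is at least [phi (Rj j)]; its far slab
    lies beyond [Rj j.+1]. All slabs of box [j] have the volume
    [2 * r * qj j ^+ n.+1], whence the difference of two consecutive [G]. The
    boxes overlap in their first coordinate, but their second coordinates, in
    [[qj j, 2 * qj j)], make them disjoint; this is where the dimension is at
    least 2. *)
Lemma outer_estimate N :
  (2 * P / (2 * d) ^+ n.+2) * (\sum_(1 <= j < N.+2) (G j - t * G j.+1))
  <= W r / r.
Proof.
pose a := qj; pose b j := Rj j.+1 + r; pose u j := 2 * qj j.
pose c j := qj j * P * p (Rj j).
have P0 : 0 < P by rewrite p_gt0// !mulr_gt0.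
have c0 j : 0 < c j by apply: mulr_gt0; [exact: mulr_gt0|exact: p_gt0].
have dd := d2; have BB := B8; have r00 := r0.
have qR j : 4 * qj j <= Rj j by rewrite qjE ler_pM2r//; lra.
have RR j : 8 * Rj j <= Rj j.+1 by rewrite RjS ler_pM2r.
have ab j : a j <= b j.
  by rewrite /a /b; have := qR j; have := RR j; have := qj0 j; lra.
pose s := index_iota 1 N.+2.
pose A j := @box R n.+1 (a j) (b j) (qj j) (u j).
have A1 j z : A j z -> qj j <= z 0 1 < u j.
  by move=> /(_ 1); rewrite /= in_itv.
have ck z : \sum_(j <- s) c j * \1_(A j) z <= gradK_pos alpha z.
  have [/hasP[i si zi]|/hasPn none] := boolP (has (fun j => z \in A j) s); last first.
    rewrite big_seq big1 ?gradK_pos_ge0// => j js.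
    by rewrite indicE (negbTE (none _ js)) mulr0.
  rewrite (bigD1_seq i) ?iota_uniq//= big1_seq => [|j /andP[ji js]].
    rewrite addr0 indicE zi mulr1; apply: kernel_on_box (set_mem zi) => //.
    - rewrite /b -mulrA -RjS; move: si; rewrite mem_index_iota => /andP[i1 _].
      have := r_le_qj i.-1; rewrite prednK//.
      by have := qR i; have := RR i; have := qj0 i; lra.
    - by rewrite -mulrA -RjS; have := Rj0 i.+1; have := qj0 i; lra.
    - by rewrite /u -mulrA -RjS; have := qR i; have := RR i; have := qj0 i; lra.
  rewrite indicE; have [zj|] := boolP (z \in A j); last by rewrite mulr0.
  have dis k l : (k < l)%N -> A k z -> A l z -> False.
    move=> kl /A1/andP[_ zk] /A1/andP[zl _].
    have h1 : qj k.+1 <= qj l by rewrite ler_pM2r ?Rj_le// invr_gt0 mulr_gt0.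
    have h2 : qj k.+1 = B * qj k by rewrite /qj RjS mulrA.
    have h3 : 8 * qj k <= B * qj k by rewrite ler_pM2r.
    by move: zk; rewrite /u; have := qj0 k; lra.
  exfalso; have := set_mem zi; have := set_mem zj.
  by case: (ltngtP i j) ji => // ij _ hj hi; apply: dis ij _ _.
have := @field_ge_boxes R n.+1 rho phi alpha rhoP m2 alpha2 alphad r s
  c a b qj u r0 (fun j => ltW (c0 j)) ab ck.
rewrite -/M -/(W r) => H.
rewrite ler_pdivlMr//; apply: le_trans H.
rewrite mulrAC mulr_sumr big_seq [leRHS]big_seq; apply: ler_sum => -[|j].
  by rewrite mem_index_iota.
move=> _; have rq := r_le_qj j; move: (j.+1) rq => k rq {j}.
have volE : u k - qj k = qj k by rewrite /u; ring.
have u0 : qj k <= u k by rewrite /u; have := qj0 k; lra.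
have Hm : phi (Rj k) * (2 * r * qj k ^+ n.+1) <=
    M (box (a k - r) (a k + r) (qj k) (u k)).
  rewrite -lee_fin MK; last exact: measurable_box_itv.
  apply: le_trans (radial_ge_volume rhoP (measurable_box_itv _ _ _ _) _).
    rewrite box_volume//; last lra.
    by rewrite -EFinM lee_fin volE; have -> : a k + r - (a k - r) = 2 * r by ring.
  move=> z zS; have z1 := zS 1; split.
    move: z1; rewrite /= in_itv/= => /andP[z1 _]; apply/eqP => z0.
    by move: z1; rewrite z0 mxE leNgt qj0.
  have -> : Rj k = n.+2%:R * (2 * qj k) by rewrite qjE -/d; ring.
  apply: enorm_le_max => i; have := zS i; rewrite ler_norml.
  by case: ifP => _; rewrite /= in_itv/= /a /u => /andP[h1 h2]; apply/andP; split;
    have := qj0 k; lra.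
have Hp : M (box (b k - r) (b k + r) (qj k) (u k)) <=
    phi (Rj k.+1) * (2 * r * qj k ^+ n.+1).
  rewrite -lee_fin MK; last exact: measurable_box_itv.
  apply: le_trans (radial_le_volume rhoP (measurable_box_itv _ _ _ _) (Rj0 k.+1) _) _.
    move=> z /(_ 0); rewrite /= in_itv/= /b => /andP[h1 _].
    apply: le_trans (enorm_coord z 0); apply: le_trans (ler_norm _).
    by move: h1; lra.
  rewrite box_volume//; last lra.
  by rewrite -EFinM lee_fin volE; have -> : b k + r - (b k - r) = 2 * r by ring.
have -> : 2 * P / (2 * d) ^+ n.+2 * r * (G k - t * G k.+1) =
  c k * (phi (Rj k) * (2 * r * qj k ^+ n.+1) -
         phi (Rj k.+1) * (2 * r * qj k ^+ n.+1)).
  rewrite -tG /G /c qjE (exprMn_comm n.+2 (mulrC (2 * d) (qj k))) !exprS.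
  by field; rewrite !gt_eqF ?exprn_gt0 ?mulr_gt0.
by rewrite ler_pM2l//; apply: lerB.
Qed.

Lemma G_le_E j : G j <= (2 * d) ^+ n.+2 * E j.
Proof.
rewrite /G /E [leRHS]mulrCA ler_pM2l ?p_gt0//.
exact: profile_le_ball.
Qed.

Lemma E_le j : E j <= p (Rj j).
Proof.
rewrite /E ler_piMr ?powR_ge0// -lee_fin MK; last exact: measurable_eball.
by apply: probability_le1; exact: measurable_eball.
Qed.

(** Passing to the next ball multiplies the power by [p B < 1] and adds a shell
    of density at most [phi (Rj j)]. *)
Lemma E_rec j : E j.+1 <= p B * E j + p B * (3 * B) ^+ n.+2 * G j.
Proof.
have h : Rj j <= Rj j.+1 by exact: Rj_le.
rewrite /E /G [p (Rj j.+1)]/p RjS -/(p _) (pM B0 (Rj0 j)).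
have -> : p B * (p (Rj j) * M (eball (Rj j))) +
   p B * (3 * B) ^+ n.+2 * (p (Rj j) * (Rj j ^+ n.+2 * phi (Rj j))) =
  p B * p (Rj j) * (M (eball (Rj j)) + phi (Rj j) * (3 * (B * Rj j)) ^+ n.+2).
  by rewrite [3 * (B * _)]mulrA (exprMn_comm n.+2 (mulrC (3 * B) (Rj j))); ring.
apply: ler_wpM2l; first by apply: mulr_ge0; exact: powR_ge0.
by rewrite -RjS; exact: ball_le_ball.
Qed.

Lemma scale_constants :
  [/\ 0 < P / 2, 0 < 2 * P / (2 * d) ^+ n.+2, 0 <= t, t < 1 & p B < 1].
Proof.
have P0 : 0 < P by rewrite p_gt0// !mulr_gt0.
split.
- exact: divr_gt0.
- by rewrite divr_gt0 ?exprn_gt0 ?mulr_gt0.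
- exact/ltW/t_gt0.
- exact: t_lt1.
- rewrite /p /powR (gt_eqF B0) expR_lt1 pmulr_llt0.
    by move: alpha2; lra.
  by rewrite ln_gt0//; have := B8; lra.
Qed.

End scales.

End dyadic_estimates.

(** The ratio [4 * n.+2] between consecutive radii leaves room for boxes
    inscribed in the balls; the first radius is [r / 2] because a ball around
    the origin has to fit in a slab of thickness [2 * r] at distance [r]. *)
Definition scale {R : realType} (n : nat) (r : R) (j : nat) : R :=
  (4 * n.+2%:R) ^+ j * (r / 2).

(** Since [2 - n.+2 < alpha], the coefficient of [G j.+1] in the box of scale [j]
    is smaller than the coefficient with which it appears at scale [j.+1]; this
    is the discrete form of the positivity of [div (gradK alpha)], and it makes
    the contributions of all scales add up. The constant does not depend on the
    measure; the last term is harmless as long as the largest radius is not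
    small. *)
Lemma field_lower_bound (R : realType) (n : nat) (alpha : R) :
  alpha < 2 -> 0 < n.+2%:R + alpha - 2 ->
  exists2 C : R, 0 < C &
    forall (rho : probability 'rV[R]_n.+2 R) (phi : R -> R),
    radial_spec rho phi -> finite_second_moment rho ->
    forall (r : R) (N : nat), 0 < r ->
    \sum_(0 <= j < N.+2)
      scale n r j `^ (alpha - 2) * fine (rho (eball (scale n r j))) <=
    C * (rV_integral rho setT (fun y => gradK alpha (axis r - y)) 0 0 / r +
         scale n r N.+1 `^ (alpha - 2)).
Proof.
move=> alpha2 alphad.
have [k0 k1 t0 t1 p1] := scale_constants alpha2 alphad.
have pB0 : 0 <= (4 * n.+2%:R : R) `^ (alpha - 2) by exact: powR_ge0.
have C20 : 0 <= (2 * n.+2%:R : R) ^+ n.+2 by rewrite exprn_ge0// mulr_ge0.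
have C30 : 0 <= (4 * n.+2%:R : R) `^ (alpha - 2) * (3 * (4 * n.+2%:R)) ^+ n.+2.
  by rewrite mulr_ge0// exprn_ge0// !mulr_ge0.
have C40 : 0 <= 4 ^+ n.+2 :> R by rewrite exprn_ge0.
have [C C0 H] := abel_bound k0 k1 t0 t1 pB0 p1 C20 C30 C40.
exists C => // rho phi rhoP m2 r N r0; set s := scale n r.
pose G j := s j `^ (alpha - 2) * (s j ^+ n.+2 * phi (s j)).
have s0 j : 0 < s j by rewrite mulr_gt0 ?exprn_gt0 ?mulr_gt0 ?divr_gt0// invr_gt0.
apply: (H _ G) => //.
- rewrite divr_ge0 ?(ltW r0)//.
  exact: (field_axis_ge0 rhoP m2 alpha2 alphad r0).
- exact: powR_ge0.
- by move=> j; rewrite mulr_ge0 ?powR_ge0// fine_ge0.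
- move=> j; rewrite mulr_ge0 ?powR_ge0// mulr_ge0 ?exprn_ge0 ?(ltW (s0 _))//.
  exact: (radial_profile_ge0 rhoP).
- exact: (inner_estimate rhoP m2 alpha2 alphad r0).
- exact: (outer_estimate rhoP m2 alpha2 alphad r0).
- apply: le_trans (G_le_E alpha rhoP r0 N.+2) _.
  apply: ler_wpM2l => //; apply: le_trans (E_le rho alpha r N.+2) _.
  apply: le0_powR_anti => //; first by rewrite subr_le0 ltW.
  rewrite [(4 * _) ^+ N.+2]exprS -mulrA ler_peMl//; first exact: ltW (s0 N.+1).
  by rewrite -natrM ler1n muln_gt0.
- exact: (G_le_E alpha rhoP r0 0).
- exact: (E_rec alpha rhoP r0).
Qed.

(** * Scalar linear equations with a damping sign *)

Section scalar_decay.
Context {R : realType}.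
Notation mu := (@lebesgue_measure R).

Section solution.
Variables (y v : R -> R) (y0 : R).
Hypotheses (y_int : forall t, 0 <= t -> mu.-integrable `[0, t] (EFin \o v) /\
    y t = y0 + \int[mu]_(s in `[0, t]) v s)
  (y_cont : forall s : R, 0 <= s -> y @ within [set t : R | 0 <= t] (nbhs s) --> y s)
  (v_sign : forall s, 0 <= s -> exists2 h, 0 <= h & v s = - h * y s).

Let integrable_sub (a b : R) : 0 <= a -> a <= b -> mu.-integrable `]a, b] (EFin \o v).
Proof.
move=> a0 ab; have [+ _] := y_int (le_trans a0 ab).
apply: integrableS => // x /=; rewrite !in_itv/= => /andP[ax ->].
by rewrite andbT ltW// (le_lt_trans a0).
Qed.

Let increment (a b : R) : 0 <= a -> a <= b ->
  y b = y a + \int[mu]_(s in `]a, b]) v s.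
Proof.
move=> a0 ab; have [ia ->] := y_int a0.
have [ib ->] := y_int (le_trans a0 ab).
rewrite -addrA; congr (_ + _).
by rewrite -(@Rintegral_itvB _ v (BLeft 0) (BRight b) a)// subrKC.
Qed.

(** After the last time [tau] at which [y] is nonnegative, [y' = - h y] is
    nonnegative, so [y] could not have become negative. *)
Lemma nonneg_stays_nonneg (a b : R) : 0 <= a -> a <= b -> 0 <= y a -> 0 <= y b.
Proof.
move=> a0 ab ya; rewrite leNgt; apply/negP => yb.
pose S := [set s | a <= s <= b /\ 0 <= y s].
have Sa : S a by split => //; rewrite lexx.
have Sub : ubound S b by move=> s [/andP[]].
have hS : has_sup S by split; [exists a|exists b].
pose tau := sup S.
have atau : a <= tau by apply: ub_le_sup => //; exists b.
have taub : tau <= b by apply: ge_sup => //; exists a.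
have tau0 : 0 <= tau by exact: le_trans atau.
have ytau : 0 <= y tau.
  rewrite leNgt; apply/negP => yt.
  have : \forall s \near within [set t : R | 0 <= t] (nbhs tau), y s < 0.
    have := y_cont tau0 => /cvgr_lt; exact.
  rewrite near_withinE => -[e /= e0 He].
  have [s Ss ts] := sup_adherent e0 hS.
  have [/andP[as_ sb] ys] := Ss.
  have : y s < 0.
    apply: He; last exact: le_trans as_.
    rewrite /ball/= ger0_norm ?subr_ge0; last by apply: ub_le_sup => //; exists b.
    by rewrite ltrBlDr -ltrBlDl.
  by rewrite ltNge ys.
have neg s : tau < s -> s <= b -> y s < 0.
  move=> ts sb; rewrite ltNge; apply/negP => ys.
  have : s <= tau.
    apply: ub_le_sup; first by exists b.
    by split => //; rewrite sb andbT (le_trans atau)// ltW.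
  by rewrite leNgt ts.
move: yb; rewrite (increment tau0 taub) ltNge => /negP; apply.
apply: addr_ge0 => //; apply: Rintegral_ge0 => s /=.
rewrite in_itv/= => /andP[ts sb].
have [h h0 ->] := v_sign (le_trans tau0 (ltW ts)).
by rewrite mulNr -mulrN mulr_ge0// oppr_ge0 ltW// neg.
Qed.

(** As [y] is nonincreasing, [y' <= - lam * y b] on the whole interval. *)
Lemma nonneg_decay (a b lam : R) : 0 <= a -> a <= b -> 0 <= lam -> 0 <= y a ->
  (forall s, a <= s <= b -> exists2 h, lam <= h & v s = - h * y s) ->
  (1 + lam * (b - a)) * y b <= y a.
Proof.
move=> a0 ab lam0 ya vlam.
have y_ge0 s : a <= s -> 0 <= y s by move=> as_; exact: nonneg_stays_nonneg ya.
have yb_le (s : R) : a <= s -> s <= b -> y b <= y s.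
  move=> as_ sb; rewrite (increment (le_trans a0 as_) sb) gerDl.
  rewrite -oppr_ge0.
  have -> : - (\int[mu]_(x in `]s, b]) v x) = \int[mu]_(x in `]s, b]) (-1 * v x).
    rewrite RintegralZl ?mulN1r//; apply: integrable_sub => //.
    exact: le_trans as_.
  apply: Rintegral_ge0 => x /=; rewrite in_itv/= => /andP[sx xb].
  have ax : a <= x by exact: le_trans as_ (ltW sx).
  have [h h0 ->] := v_sign (le_trans a0 ax).
  by rewrite mulN1r mulNr opprK mulr_ge0// y_ge0.
have : y b <= y a - lam * (b - a) * y b.
  rewrite {1}(increment a0 ab) lerD2l.
  have -> : - (lam * (b - a) * y b) = \int[mu]_(x in `]a, b]) (- (lam * y b)).
    rewrite Rintegral_cst//= lebesgue_measure_itv/= lte_fin.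
    case: ltP => [_|ba]; first by rewrite -EFinD/=; ring.
    have -> : b = a by apply/eqP; rewrite eq_le ba.
    by rewrite /= subrr; ring.
  apply: le_Rintegral => //.
  - exact: integrable_sub.
  - apply: (@integrableS _ _ _ mu `[a, b]) => //.
      by apply: subset_itvr; rewrite bnd_simp.
    apply: continuous_compact_integrable; first exact: segment_compact.
    by apply: continuous_subspaceT => x; exact: cvg_cst.
  move=> x /=; rewrite in_itv/= => /andP[ax xb].
  have [|h hl ->] := vlam x; first by rewrite (ltW ax).
  rewrite mulNr lerN2; apply: ler_pM => //; first by apply: y_ge0.
  by apply: yb_le => //; exact: ltW.
by lra.
Qed.

End solution.

(** A continuous solution of [y' = - h y] with [h >= 0] never changes sign
    and cannot grow; if [h >= lam] the backward Euler inequality holds. *)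
Lemma abs_decay (y v : R -> R) (y0 a b lam : R) :
  (forall t, 0 <= t -> mu.-integrable `[0, t] (EFin \o v) /\
    y t = y0 + \int[mu]_(s in `[0, t]) v s) ->
  (forall s : R, 0 <= s -> y @ within [set t : R | 0 <= t] (nbhs s) --> y s) ->
  (forall s, 0 <= s -> exists2 h, 0 <= h & v s = - h * y s) ->
  0 <= a -> a <= b -> 0 <= lam ->
  (forall s, a <= s <= b -> exists2 h, lam <= h & v s = - h * y s) ->
  (1 + lam * (b - a)) * `|y b| <= `|y a|.
Proof.
move=> yi yc vs a0 ab lam0 vlam.
have [ya|ya] := leP 0 (y a).
  rewrite !ger0_norm//; first exact: (nonneg_decay yi yc vs).
  exact: (nonneg_stays_nonneg yi yc vs a0 ab ya).
have yi' t : 0 <= t -> mu.-integrable `[0, t] (EFin \o (fun s => - v s)) /\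
    - y t = - y0 + \int[mu]_(s in `[0, t]) (- v s).
  move=> t0; have [iv ->] := yi _ t0; split.
    exact: (integrableN iv).
  rewrite opprD; congr (_ + _).
  under [RHS]eq_Rintegral do rewrite -mulN1r.
  by rewrite RintegralZl// mulN1r.
have yc' (s : R) : 0 <= s -> (fun t => - y t) @ within [set t : R | 0 <= t] (nbhs s) --> - y s.
  by move=> s0; apply: cvgN; exact: yc.
have sg l s : (exists2 h, l <= h & v s = - h * y s) ->
    exists2 h, l <= h & - v s = - h * - y s.
  by move=> [h h0 ->]; exists h => //; rewrite mulrN.
have ya' : 0 <= - y a by rewrite oppr_ge0 ltW.
have := nonneg_decay yi' yc' (fun s s0 => sg _ _ (vs s s0)) a0 ab lam0 ya'
  (fun s sab => sg _ _ (vlam s sab)).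
have := nonneg_stays_nonneg yi' yc' (fun s s0 => sg _ _ (vs s s0)) a0 ab ya'.
by rewrite -normrN -(normrN (y a)) => h1 h2; rewrite !ger0_norm.
Qed.

End scalar_decay.

(** * Trajectories *)

Section trajectories.
Context {R : realType} {n : nat}.
Variables (alpha : R) (rho_init : probability 'rV[R]_n.+2 R)
  (rho : R -> probability 'rV[R]_n.+2 R) (sigma : R -> 'rV[R]_n.+2 -> 'rV[R]_n.+2).
Hypotheses (alpha2 : alpha < 2) (alphad : 0 < n.+2%:R + alpha - 2).
Hypothesis rhoP : forall t, 0 <= t -> PRD (rho t) /\ finite_second_moment (rho t).
Hypothesis sigma_cont :
  {within [set tx : R * 'rV[R]_n.+2 | 0 <= tx.1],
    continuous (fun tx => sigma tx.1 tx.2)}.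
Hypothesis sigma_push : forall t, 0 <= t -> forall A, measurable A ->
  rho t A = pushforward rho_init (sigma t) A.
Hypothesis sigma_int : forall x t, 0 <= t ->
  let v := fun s => velocity alpha rho (sigma s x) s in
  rV_integrable (@lebesgue_measure R) `[0, t] v /\
  sigma t x = x + rV_integral (@lebesgue_measure R) `[0, t] v.

(** Relative inward speed at distance [r] from the origin. *)
Definition rate (s r : R) : R :=
  rV_integral (rho s) setT (fun y => gradK alpha (axis r - y)) 0 0 / r.

Lemma velocityE x s : 0 <= s ->
  velocity alpha rho x s = - (rate s (enorm x) *: x).
Proof.
move=> s0; rewrite /velocity; case: eqP => [->|/eqP x0].
  by rewrite scaler0 oppr0.
have [/PRD_radial_spec[phi sp] m2] := rhoP s0.
by rewrite (field_radial sp m2 alpha2 alphad x0).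
Qed.

Lemma rate_ge0 s r : 0 <= s -> 0 < r -> 0 <= rate s r.
Proof.
move=> s0 r0; have [/PRD_radial_spec[phi sp] m2] := rhoP s0.
by rewrite divr_ge0 ?(ltW r0)//; exact: (field_axis_ge0 sp m2 alpha2 alphad).
Qed.

Lemma rate_lower_bound : exists2 C : R, 0 < C & forall s r N, 0 <= s -> 0 < r ->
  \sum_(0 <= j < N.+2)
    scale n r j `^ (alpha - 2) * fine (rho s (eball (scale n r j))) <=
  C * (rate s r + scale n r N.+1 `^ (alpha - 2)).
Proof.
have [C C0 H] := field_lower_bound alpha2 alphad; exists C => // s r N s0 r0.
have [/PRD_radial_spec[phi sp] m2] := rhoP s0.
exact: H sp m2 _ _ r0.
Qed.

Lemma sigma_cvg (s : R) x : 0 <= s ->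
  sigma tx.1 tx.2 @[tx --> within [set tx : R * 'rV[R]_n.+2 | 0 <= tx.1] (nbhs (s, x))]
    --> sigma s x.
Proof.
move=> s0; move/subspace_continuousP : sigma_cont => /(_ (s, x)); exact.
Qed.

Lemma sigma_cvg_time (s : R) x i : 0 <= s ->
  (fun t => sigma t x 0 i) @ within [set t : R | 0 <= t] (nbhs s) -->
    sigma s x 0 i.
Proof.
move=> s0; apply: (@cvg_comp _ _ _ (fun t => sigma t x)
  (fun z : 'rV[R]_n.+2 => z 0 i)); last exact: coord_continuous.
move=> U /(sigma_cvg s0); rewrite !nbhs_filterE /= => -[[V1 V2]/= [V1s V2x] V].
apply: filterS V1s => t V1t t0; apply: (V (t, x)) => //=; split => //=.
exact: nbhs_singleton V2x.
Qed.

Lemma continuous_sigma (s : R) : 0 <= s -> continuous (sigma s).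
Proof.
move=> s0 x U /(sigma_cvg s0); rewrite !nbhs_filterE /= => -[[V1 V2]/= [V1s V2x] V].
apply: filterS V2x => y V2y; apply: (V (s, y)) => //=; split => //=.
exact: nbhs_singleton V1s.
Qed.

Lemma sigma0 x : sigma 0 x = x.
Proof.
have [_ ->] := sigma_int x (lexx 0); rewrite -[RHS]addr0; congr (_ + _).
apply/rowP => i; rewrite !mxE set_itv1; exact: Rintegral_set1.
Qed.

(** The velocity is a nonpositive multiple of the position, so each coordinate
    solves a scalar equation [y' = - h y]. At the origin the velocity vanishes
    and any multiple will do. *)
Lemma sigma_decay x (a b lam : R) : 0 <= a -> a <= b -> 0 <= lam ->
  (forall s, a <= s <= b -> sigma s x != 0 ->
     lam <= rate s (enorm (sigma s x))) ->
  (1 + lam * (b - a)) * enorm (sigma b x) <= enorm (sigma a x).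
Proof.
move=> a0 ab lam0 H.
have k0 : 0 <= 1 + lam * (b - a) by rewrite addr_ge0// mulr_ge0// subr_ge0.
rewrite -{1}(ger0_norm k0) -enormZ; apply: enorm_le => i.
rewrite mxE normrM (ger0_norm k0).
have vE (s l : R) : 0 <= s ->
    (sigma s x != 0 -> l <= rate s (enorm (sigma s x))) ->
    exists2 h, l <= h &
      velocity alpha rho (sigma s x) s 0 i = - h * sigma s x 0 i.
  move=> s0 hl; rewrite velocityE//; have [->|/hl lh] := eqVneq (sigma s x) 0.
    by exists l => //; rewrite scaler0 oppr0 !mxE mulr0.
  by exists (rate s (enorm (sigma s x))) => //; rewrite !mxE mulNr.
apply: (@abs_decay R (fun s => sigma s x 0 i)
  (fun s => velocity alpha rho (sigma s x) s 0 i) (x 0 i)) => //.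
- move=> t t0; have [iv sE] := sigma_int x t0; split; first exact: iv.
  by rewrite {1}sE !mxE.
- by move=> s s0; exact: sigma_cvg_time.
- move=> s s0; apply: vE => // sx; apply: rate_ge0 => //.
  by rewrite enorm_gt0.
- move=> s /[dup] sab /andP[as_ _]; apply: vE; first exact: le_trans as_.
  exact: H.
Qed.

(** Points that start within [r] and end up within [r'] carry their mass
    along. *)
Lemma mass_transport (s r r' : R) : 0 <= s ->
  (forall x, enorm x <= r -> enorm (sigma s x) <= r') ->
  fine (rho_init (eball r)) <= fine (rho s (eball r')).
Proof.
move=> s0 H.
have ms : measurable_fun setT (sigma s).
  exact: continuous_measurable_rV (continuous_sigma s0).
have mr k := @measurable_eball R n.+2 k.
rewrite fine_le//; [exact: fin_num_measure|exact: fin_num_measure|].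
rewrite sigma_push// /pushforward; apply: le_measureS => //.
exact: measurable_preim.
Qed.

Lemma mass_at_origin (t r : R) : 0 <= t ->
  (forall x, enorm x <= r -> sigma t x = 0) ->
  (rho_init (eball r) <= rho t [set 0%R])%E.
Proof.
move=> t0 H.
have ms : measurable_fun setT (sigma t).
  exact: continuous_measurable_rV (continuous_sigma t0).
have m0 : measurable [set 0%R : 'rV[R]_n.+2].
  have -> : [set 0%R] = @eball R n.+2 0.
    apply/seteqP; split => x; rewrite /eball /=; first by move=> ->; rewrite enorm0.
    move=> x0; apply/eqP; rewrite -enorm_eq0; apply/eqP.
    by apply/le_anti; rewrite x0 enorm_ge0.
  exact: measurable_eball.
rewrite sigma_push// /pushforward; apply: le_measureS.
- exact: measurable_eball.
- exact: measurable_preim.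
- by move=> x /H.
Qed.

End trajectories.

(** * Concentration at the origin *)

Section large_numbers.
Context {R : realType}.

Lemma powR_unbounded (eps K : R) : 0 < eps ->
  exists n0, forall n, (n0 <= n)%N -> K <= n%:R `^ eps.
Proof.
move=> eps0; pose K' := Num.max K 1.
have K'1 : 1 <= K' by rewrite le_max lexx orbT.
exists (Num.bound (K' `^ eps^-1)) => n hn.
have h : K' `^ eps^-1 <= n%:R.
  apply: le_trans (ltW (archi_boundP (powR_ge0 _ _))) _.
  by rewrite ler_nat.
apply: (@le_trans _ _ K'); first by rewrite le_max lexx.
have -> : K' = (K' `^ eps^-1) `^ eps.
  by rewrite -powRrM mulVf ?gt_eqF// powRr1// (le_trans _ K'1).
by apply: ge0_ler_powR; rewrite ?nnegrE ?powR_ge0 ?(ltW eps0).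
Qed.

Lemma natr_unbounded (K : R) : exists n0, forall n, (n0 <= n)%N -> K <= n%:R.
Proof.
have [n0 H] := powR_unbounded K ltr01.
by exists n0 => n /H; rewrite powRr1.
Qed.

Lemma expr_small (b eps : R) : 0 < b -> b < 1 -> 0 < eps ->
  exists n0, forall n, (n0 <= n)%N -> b ^+ n < eps.
Proof.
move=> b0 b1 eps0.
have := @cvg_geometric R 1 b; rewrite ger0_norm ?ltW// => /(_ b1).
move/cvgr_lt => /(_ _ eps0)[m _ H]; exists m => n mn.
by have := H n mn; rewrite /= mul1r.
Qed.

End large_numbers.

(** The mechanism of the blow-up, stripped of the geometry. A point at distance
    [dist s x] from the origin approaches it at relative speed [rate]; the speed
    is bounded below by the masses [M s] of the balls, which dominate the
    initial masses [m0] since all points move inwards. *)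
Section concentration.
Context {R : realType} {X : Type}.
Variables (M rate : R -> R -> R) (dist : R -> X -> R) (m0 : R -> R)
  (alpha B C c1 r0 beta : R).
Let p (x : R) := x `^ (alpha - 2).
Hypotheses (alpha2 : alpha < 2) (B8 : 8 <= B) (C0 : 0 < C) (c10 : 0 < c1)
  (r00 : 0 < r0) (r01 : r0 <= 1) (beta0 : 0 < beta) (beta1 : beta < 1).
Hypothesis dist_ge0 : forall s x, 0 <= dist s x.
Hypothesis M_ge0 : forall s r, 0 <= M s r.
Hypothesis rate_ge0 : forall s r, 0 <= s -> 0 < r -> 0 <= rate s r.
Hypothesis rate_lb : forall s r N, 0 <= s -> 0 < r ->
  \sum_(0 <= j < N.+2) p (B ^+ j * (r / 2)) * M s (B ^+ j * (r / 2)) <=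
  C * (rate s r + p (B ^+ N.+1 * (r / 2))).
Hypothesis dist_decay : forall x a b lam, 0 <= a -> a <= b -> 0 <= lam ->
  (forall s, a <= s <= b -> 0 < dist s x -> lam <= rate s (dist s x)) ->
  (1 + lam * (b - a)) * dist b x <= dist a x.
Hypothesis transport : forall s r r', 0 <= s ->
  (forall x, dist 0 x <= r -> dist s x <= r') -> m0 r <= M s r'.
Hypothesis m0_lb : forall r, 0 < r -> r < r0 ->
  c1 / ln (B / (2 * r)) `^ beta <= p r * m0 r.

Let b : R := B^-1.
Let L : R := 3 * ln B.

Let B0 : 0 < B. Proof. exact: lt_le_trans B8. Qed.
Let b0 : 0 < b. Proof. by rewrite invr_gt0. Qed.
Let b1 : b < 1. Proof. by rewrite invf_lt1//; apply: lt_le_trans B8; rewrite ltr1n. Qed.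
Let L0 : 0 < L.
Proof. by rewrite mulr_gt0// ln_gt0//; apply: lt_le_trans B8; rewrite ltr1n. Qed.
Let bn0 n : 0 < b ^+ n. Proof. exact: exprn_gt0. Qed.
Let bn_le m n : (m <= n)%N -> b ^+ n <= b ^+ m.
Proof. by move=> mn; rewrite ler_wiXn2l// ltW. Qed.
Let BbM n : B ^+ n * b ^+ n = 1.
Proof. by rewrite -exprMn divff ?expr1n// gt_eqF. Qed.
Let alpha2' : alpha - 2 <= 0. Proof. by rewrite subr_le0 ltW. Qed.
Let p_gt0 x : 0 < x -> 0 < p x. Proof. exact: powR_gt0. Qed.
Let p_anti x y : 0 < x -> x <= y -> p y <= p x.
Proof. exact: le0_powR_anti. Qed.
Let pM x y : 0 < x -> 0 < y -> p (x * y) = p x * p y.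
Proof. by move=> x0 y0; rewrite /p powRM// ltW. Qed.

Let dist_noninc x s t : 0 <= s -> s <= t -> dist t x <= dist s x.
Proof.
move=> s0 st; have := @dist_decay x s t 0 s0 st (lexx 0).
rewrite mul0r addr0 mul1r; apply => u /andP[su _] u0.
by rewrite rate_ge0// (le_trans s0).
Qed.

Let m0_le_M s r : 0 <= s -> m0 r <= M s r.
Proof.
move=> s0; apply: transport => // x; apply: le_trans; exact: dist_noninc.
Qed.

(* In powers of [B] the logarithm becomes a multiple of the exponent. *)
Let m0_lb_dyadic n r : (0 < n)%N -> b ^+ n.+1 / 2 <= r -> r < r0 ->
  c1 / (L * n%:R) `^ beta <= p r * m0 r.
Proof.
move=> n0 hr rr0.
have r_gt0 : 0 < r by apply: lt_le_trans hr; rewrite divr_gt0.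
apply: le_trans (m0_lb r_gt0 rr0); rewrite ler_pM2l//.
have BB := B8; have rr01 := r01.
have q1 : 1 < B / (2 * r) by rewrite ltr_pdivlMr ?mulr_gt0//; lra.
have l0 : 0 < ln (B / (2 * r)) by rewrite ln_gt0.
rewrite lef_pV2 ?posrE ?powR_gt0//; last by rewrite mulr_gt0// ltr0n.
apply: ge0_ler_powR; rewrite ?nnegrE ?(ltW beta0) ?(ltW l0)//.
  by rewrite mulr_ge0 ?(ltW L0).
have h : B / (2 * r) <= B ^+ n.+2.
  rewrite ler_pdivrMr ?mulr_gt0//.
  have h1 : b ^+ n.+1 <= 2 * r by rewrite mulrC -ler_pdivrMr.
  rewrite [B ^+ _]exprS -mulrA -[leLHS]mulr1 ler_pM2l// -[leLHS](BbM n.+1).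
  by rewrite ler_pM2l// exprn_gt0.
apply: (@le_trans _ _ (ln (B ^+ n.+2))).
  by rewrite ler_ln ?posrE ?exprn_gt0// (lt_trans _ q1).
rewrite lnXn// -[leLHS]mulr_natl.
have -> : L * n%:R = (3 * n%:R) * ln B by rewrite /L; ring.
apply: ler_wpM2r; first by rewrite ln_ge0//; lra.
have n1 : 1 <= n%:R :> R by rewrite ler1n.
by rewrite -addn2 natrD; lra.
Qed.

(** For [B ^ (- k - 1) < r <= B ^ (- k)] there are about [k] scales between [r]
    and [r0], each contributing at least a multiple of [k ^ (- beta)]; the
    boundary term at the largest scale is bounded. This grows since
    [beta < 1]. *)
Lemma rate_large : exists2 a : R, 0 < a & exists n0, forall n s r,
  (n0 <= n)%N -> 0 <= s -> 0 < r -> r <= b ^+ n ->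
  a * n%:R `^ (1 - beta) <= rate s r.
Proof.
have [q0 Hq0] := expr_small b0 b1 r00.
pose K := p (b ^+ q0.+1 / 2).
pose a2 := c1 / (2 * L `^ beta * C).
have a20 : 0 < a2 by rewrite divr_gt0// !mulr_gt0// powR_gt0.
have eps0 : 0 < 1 - beta by rewrite subr_gt0.
have [n1 Hn1] := powR_unbounded (2 * K / a2) eps0.
exists (a2 / 2); first exact: divr_gt0.
exists (maxn n1 (2 * q0).+2) => n s r; rewrite geq_max => /andP[nn1 nq0] s0 rr rb.
have exk : exists k, b ^+ k.+1 < r.
  by have [k Hk] := expr_small b0 b1 rr; exists k; apply: Hk.
have [k bkr kmin] := ex_minnP exk.
have nk : (n <= k)%N.
  rewrite leqNgt; apply/negP => kn.
  have : b ^+ n <= b ^+ k.+1 by exact: bn_le.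
  by rewrite leNgt (lt_le_trans bkr rb).
have rbk : r <= b ^+ k.
  case: k bkr kmin nk => [|k] bkr kmin nk; last first.
    by rewrite leNgt; apply/negP => /kmin; rewrite ltnn.
  by apply: le_trans rb _; rewrite expr0 exprn_ile1// ltW.
have kq : (2 * q0 < k)%N by apply: leq_trans nk; apply: leq_trans nq0.
have k0 : (0 < k)%N by exact: leq_trans kq.
have q0k : (q0 < k)%N by apply: leq_ltn_trans kq; rewrite leq_pmull.
pose N := (k - q0).-1.
have NE : N.+1 = (k - q0)%N by rewrite /N prednK// subn_gt0.
have term j : (j < N.+2)%N -> c1 / (L * k%:R) `^ beta <=
    p (B ^+ j * (r / 2)) * M s (B ^+ j * (r / 2)).
  rewrite ltnS NE => jN; set rj := B ^+ j * (r / 2).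
  have B1 : 1 <= B by apply: le_trans B8; rewrite ler1n.
  have rjl : r / 2 <= rj by rewrite /rj ler_peMl ?exprn_ege1// ltW// divr_gt0.
  have rj0 : 0 < rj by apply: lt_le_trans rjl; rewrite divr_gt0.
  have rjr0 : rj < r0.
    apply: le_lt_trans (Hq0 q0 (leqnn _)).
    apply: (@le_trans _ _ (B ^+ (k - q0) * b ^+ k)).
      apply: ler_pM; [exact/ltW/exprn_gt0|by rewrite ltW// divr_gt0|exact: ler_weXn2l|].
      by apply: le_trans rbk; rewrite ler_pdivrMr//; lra.
    by rewrite -{2}(subnK (ltnW q0k)) exprD mulrA BbM mul1r.
  apply: (@le_trans _ _ (p rj * m0 rj)); last first.
    by rewrite ler_pM2l ?p_gt0// m0_le_M.
  apply: m0_lb_dyadic => //; apply: le_trans rjl.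
  by rewrite ler_pM2r// ltW.
have lb := rate_lb N s0 rr.
have sumlb : N.+2%:R * (c1 / (L * k%:R) `^ beta) <= C * (rate s r + K).
  apply: (@le_trans _ _ (C * (rate s r + p (B ^+ N.+1 * (r / 2))))).
    apply: le_trans lb.
    rewrite mulr_natl -[X in _ *+ X](subn0 N.+2) -sumr_const_nat.
    by rewrite big_nat [leRHS]big_nat; apply: ler_sum => j /andP[_ jN]; exact: term.
  rewrite ler_pM2l// lerD2l; apply: p_anti; first by rewrite divr_gt0.
  rewrite mulrA ler_pM2r// NE.
  have -> : b ^+ q0.+1 = B ^+ (k - q0) * b ^+ k.+1.
    have -> : k.+1 = (k - q0 + q0.+1)%N by rewrite addnS subnK// ltnW.
    by rewrite exprD mulrA BbM mul1r.
  by rewrite ler_pM2l ?exprn_gt0// ltW.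
have kR0 : 0 < k%:R :> R by rewrite ltr0n.
have khalf : k%:R / 2 <= N.+2%:R :> R.
  rewrite ler_pdivrMr// -natrM ler_nat NE.
  by move: kq q0k; clear; lia.
have kpow : k%:R / 2 * (c1 / (L * k%:R) `^ beta) = C * (a2 * k%:R `^ (1 - beta)).
  have -> : (k%:R : R) `^ (1 - beta) = k%:R / k%:R `^ beta.
    by rewrite powRB ?powRr1 ?ltW// (gt_eqF kR0) implybT.
  rewrite powRM ?(ltW L0) ?ltW// /a2; field.
  by rewrite !gt_eqF ?powR_gt0.
have main : a2 * k%:R `^ (1 - beta) <= rate s r + K.
  rewrite -(ler_pM2l C0) -kpow; apply: le_trans sumlb.
  by apply: ler_wpM2r => //; rewrite divr_ge0 ?powR_ge0 ?ltW.
have Kk : 2 * K <= a2 * k%:R `^ (1 - beta).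
  by have := Hn1 k (leq_trans nn1 nk); rewrite ler_pdivrMr//; lra.
have nkp : n%:R `^ (1 - beta) <= k%:R `^ (1 - beta) :> R.
  by apply: ge0_ler_powR; rewrite ?nnegrE ?ler_nat// ltW.
have : a2 * n%:R `^ (1 - beta) <= a2 * k%:R `^ (1 - beta) by rewrite ler_pM2l.
by lra.
Qed.

(** At relative speed [a * n ^ (1 - beta)], [q] steps of backward Euler over a
    fixed time contract by [n ^ ((1 - beta) * q)] up to a constant, which beats
    any given power of [n]. *)
Lemma early_contraction (T : R) (m : nat) : 0 < T ->
  exists n1, forall n x s, (n1 <= n)%N -> dist 0 x <= b ^+ n -> T <= s ->
  n%:R ^+ m * dist s x <= b ^+ n.
Proof.
move=> T0; have [a a0 [n0 Hrate]] := rate_large.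
have eps0 : 0 < 1 - beta by rewrite subr_gt0.
have [q Hq] := natr_unbounded (m.+1%:R / (1 - beta)).
have qm : m.+1%:R <= (1 - beta) * q.+1%:R.
  by have := Hq q.+1 (leqnSn q); rewrite ler_pdivrMr// mulrC.
pose tau := T / q.+1%:R.
have tau0 : 0 < tau by rewrite divr_gt0.
have atau0 : 0 < a * tau by rewrite mulr_gt0.
have [n2 Hn2] := natr_unbounded (((a * tau) ^+ q.+1)^-1).
exists (maxn (maxn n0 n2) 1) => n x s; rewrite !geq_max => /andP[/andP[n0n n2n] n_gt0] xb Ts.
have nR1 : 1 <= n%:R :> R by rewrite ler1n.
have nR0 : 0 < n%:R :> R by exact: lt_le_trans nR1.
pose lam := a * n%:R `^ (1 - beta).
have lam0 : 0 < lam by rewrite mulr_gt0// powR_gt0.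
have step k : (1 + lam * tau) ^+ k * dist (k%:R * tau) x <= dist 0 x.
  elim: k => [|k IH]; first by rewrite mul0r expr0 mul1r.
  apply: le_trans IH; rewrite exprSr -mulrA ler_wpM2l//.
    by rewrite exprn_ge0// addr_ge0// mulr_ge0 ?(ltW tau0) ?(ltW lam0).
  have -> : lam * tau = lam * (k.+1%:R * tau - k%:R * tau) by rewrite -natr1; ring.
  apply: dist_decay.
  - by rewrite mulr_ge0// ltW.
  - by rewrite ler_pM2r// ler_nat.
  - exact: ltW.
  move=> u /andP[ku _] du; have u0 : 0 <= u.
    by apply: le_trans ku; rewrite mulr_ge0// ltW.
  apply: Hrate => //; apply: le_trans xb; exact: dist_noninc.
have Tq : q.+1%:R * tau = T by rewrite /tau mulrC divfK.
have := step q.+1; rewrite Tq => big.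
apply: le_trans xb; apply: le_trans big; apply: ler_pM => //.
- apply: (@le_trans _ _ ((lam * tau) ^+ q.+1)); last first.
    rewrite lerXn2r ?nnegrE//.
    - by rewrite mulr_ge0// ltW.
    - by rewrite addr_ge0// mulr_ge0// ltW.
    - by rewrite lerDr.
  have -> : lam * tau = (a * tau) * n%:R `^ (1 - beta) by rewrite /lam; ring.
  have hE : (n%:R `^ (1 - beta)) ^+ q.+1 = n%:R `^ ((1 - beta) * q.+1%:R) :> R.
    by rewrite -powR_mulrn ?powR_ge0// -powRrM.
  rewrite exprMn hE.
  have h1 : n%:R ^+ m.+1 <= n%:R `^ ((1 - beta) * q.+1%:R) :> R.
    by rewrite -powR_mulrn// ler_powR.
  have h2 : 1 <= (a * tau) ^+ q.+1 * n%:R.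
    by rewrite -ler_pdivrMl ?exprn_gt0// mulr1; exact: Hn2.
  apply: (@le_trans _ _ ((a * tau) ^+ q.+1 * n%:R ^+ m.+1)).
    by rewrite (exprS n%:R m) mulrA ler_peMl// exprn_ge0.
  by rewrite ler_pM2l ?exprn_gt0.
- by apply: dist_noninc => //; exact: ltW.
Qed.

Let shell m n : R := b ^+ n / n%:R ^+ m.

(** After the contraction, the ball of radius [shell m n.+1] contains the mass
    that was initially in the ball of radius [b ^ (n + 1)]. This multiplies the
    innermost term of the lower bound by [n ^ ((2 - alpha) * m) >= n ^ 4], which
    outweighs the logarithmic factor. *)
Lemma rate_superlinear (T : R) (m : nat) : 0 < T -> 4 <= (2 - alpha) * m%:R ->
  exists n2, forall n s r, (n2 <= n)%N -> T <= s ->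
  2 * shell m n.+1 < r -> r <= 2 * shell m n -> n%:R * n.+1%:R <= rate s r.
Proof.
move=> T0 hm; have [n1 H1] := early_contraction m T0.
have [nr Hnr] := expr_small b0 b1 r00.
pose c3 := p B * c1 / (1 + L).
have c30 : 0 < c3 by apply: divr_gt0; [rewrite mulr_gt0// p_gt0|rewrite addr_gt0].
have [n3 H3] := natr_unbounded (3 * C / c3).
exists (maxn (maxn n1 nr) (maxn n3 1)) => n s r.
rewrite !geq_max => /andP[/andP[n1n nrn] /andP[n3n n_gt0]] Ts rlo rhi.
have nR1 : 1 <= n%:R :> R by rewrite ler1n.
have nR0 : 0 < n%:R :> R by exact: lt_le_trans nR1.
have s0 : 0 <= s by exact: le_trans (ltW T0) Ts.
have shell0 k : (0 < k)%N -> 0 < shell m k.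
  by move=> k0; rewrite divr_gt0// exprn_gt0// ltr0n.
have rr : 0 < r by apply: lt_trans rlo; rewrite mulr_gt0// shell0.
have r20 : 0 < r / 2 by rewrite divr_gt0.
(* the scales at which the masses are sampled reach size 1 *)
have [N HN] : exists N, 1 <= B ^+ N.+1 * (r / 2).
  have [N HN] := expr_small b0 b1 r20; exists N.
  have := HN N.+1 (leqnSn N) => /ltW h.
  by rewrite -[leLHS](BbM N.+1) ler_pM2l ?exprn_gt0.
have lb := rate_lb N s0 rr.
have first_term : p (r / 2) * M s (r / 2) <= C * (rate s r + 1).
  apply: (@le_trans _ _ (C * (rate s r + p (B ^+ N.+1 * (r / 2))))).
    apply: le_trans lb; rewrite big_nat_recl//= expr0 mul1r lerDl.
    by apply: sumr_ge0 => j _; rewrite mulr_ge0// powR_ge0.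
  rewrite ler_pM2l// lerD2l.
  by apply: le_trans (p_anti ltr01 HN) _; rewrite /p powR1.
have mass : m0 (b ^+ n.+1) <= M s (r / 2).
  apply: transport => // x hx.
  have := H1 n.+1 x s (leq_trans n1n (leqnSn n)) hx Ts.
  rewrite mulrC -ler_pdivlMr ?exprn_gt0// => /le_trans; apply.
  by rewrite -/(shell m n.+1) ler_pdivlMr// mulrC ltW.
have init : c1 / (L * n%:R) `^ beta <= p (b ^+ n.+1) * m0 (b ^+ n.+1).
  apply: m0_lb_dyadic => //.
    by rewrite ler_pdivrMr// ler_peMr ?(ltW (bn0 _))// ler1n.
  by apply: Hnr; apply: leq_trans nrn _.
have logn : (L * n%:R) `^ beta <= (1 + L) * n%:R.
  apply: (@le_trans _ _ (((1 + L) * n%:R) `^ beta)).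
    apply: ge0_ler_powR; rewrite ?nnegrE ?(ltW beta0)//.
    - by rewrite mulr_ge0// ltW.
    - by rewrite mulr_ge0// addr_ge0// ltW.
    - by rewrite ler_pM2r// lerDr.
  apply: ler1_powR; last exact: ltW.
  by rewrite -[leLHS]mulr1 ler_pM// lerDl ltW.
have c1n : c1 / ((1 + L) * n%:R) <= c1 / (L * n%:R) `^ beta.
  rewrite ler_pM2l// lef_pV2// posrE; first by rewrite mulr_gt0// addr_gt0.
  by rewrite powR_gt0// mulr_gt0.
have pn4 : n%:R ^+ 4 <= p ((n%:R ^+ m)^-1).
  have -> : p ((n%:R ^+ m)^-1) = n%:R `^ ((2 - alpha) * m%:R).
    rewrite /p -powR_inv1 ?exprn_ge0// -powR_mulrn// -!powRrM.
    by congr powR; ring.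
  by rewrite -powR_mulrn// ler_powR.
have gain : p B * n%:R ^+ 4 * p (b ^+ n.+1) <= p (r / 2).
  apply: (@le_trans _ _ (p (shell m n))); last first.
    by apply: p_anti => //; rewrite ler_pdivrMr// mulrC.
  rewrite /shell pM ?invr_gt0 ?exprn_gt0//.
  have -> : b ^+ n = B * b ^+ n.+1 by rewrite exprS mulrA divff ?mul1r// gt_eqF.
  rewrite (pM B0 (bn0 n.+1)) [leRHS]mulrAC ler_pM2r ?p_gt0//.
  by rewrite ler_pM2l// p_gt0.
have chain : c3 * n%:R ^+ 3 <= C * (rate s r + 1).
  apply: le_trans first_term.
  apply: (@le_trans _ _ (p (r / 2) * m0 (b ^+ n.+1))); last first.
    by rewrite ler_pM2l ?p_gt0.
  have m00 : 0 <= m0 (b ^+ n.+1).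
    rewrite -(pmulr_rge0 _ (p_gt0 (bn0 n.+1))); apply: le_trans init.
    by rewrite divr_ge0 ?powR_ge0// ltW.
  apply: (@le_trans _ _ (p B * n%:R ^+ 4 * p (b ^+ n.+1) * m0 (b ^+ n.+1))); last first.
    exact: ler_wpM2r.
  rewrite -[leRHS]mulrA.
  have -> : c3 * n%:R ^+ 3 = p B * n%:R ^+ 4 * (c1 / ((1 + L) * n%:R)).
    rewrite /c3; field; rewrite gt_eqF//= gt_eqF// addr_gt0//.
  rewrite ler_pM2l; last by rewrite mulr_gt0 ?exprn_gt0// p_gt0.
  exact: le_trans init.
have n3' : 3 * C <= c3 * n%:R by have := H3 n n3n; rewrite ler_pdivrMr//; lra.
have : 3 * C * n%:R ^+ 2 <= C * (rate s r + 1).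
  apply: le_trans chain; rewrite [n%:R ^+ 3]exprS mulrA ler_pM2r//.
  exact: exprn_gt0.
have -> : 3 * C * n%:R ^+ 2 = C * (3 * n%:R ^+ 2) by ring.
rewrite ler_pM2l// => fin.
rewrite -natr1; have : n%:R <= n%:R ^+ 2 :> R by rewrite expr2 ler_peMr// ltW.
by move: fin nR1; rewrite expr2; lra.
Qed.

(** At relative speed [n * (n + 1)], going from radius [2 * shell m n] to
    [2 * shell m n.+1], a bounded ratio [Gam], takes the time
    [Gam / n - Gam / n.+1]. These times telescope, so the infinitely many
    scales are crossed before time [t]. *)
Lemma reaches_origin (t : R) : 0 < t ->
  exists2 r, 0 < r & forall x, dist 0 x <= r -> dist t x = 0.
Proof.
move=> t0; have T0 : 0 < t / 2 by rewrite divr_gt0.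
have k0 : 0 < 2 - alpha by rewrite subr_gt0.
have [m0' Hm] := natr_unbounded (4 / (2 - alpha)).
pose m := m0'.+1.
have hm : 4 <= (2 - alpha) * m%:R.
  by have := Hm m (leqnSn _); rewrite ler_pdivrMr//; lra.
have [n2 H2] := rate_superlinear T0 hm.
pose Gam : R := B * 2 ^+ m.
have Gam0 : 0 < Gam by rewrite mulr_gt0// exprn_gt0.
have [n3 H3] := natr_unbounded (Gam / (t / 2)).
pose n0 := maxn (maxn n2 n3) 1.
have shell0 k : (0 < k)%N -> 0 < shell m k.
  by move=> k0'; rewrite divr_gt0// exprn_gt0// ltr0n.
have shellS k : (0 < k)%N -> shell m k <= Gam * shell m k.+1.
  move=> kk; have kR : 0 < k%:R :> R by rewrite ltr0n.
  rewrite /shell /Gam exprS.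
  have -> : B * 2 ^+ m * (b * b ^+ k / k.+1%:R ^+ m) =
            b ^+ k * (2 / k.+1%:R) ^+ m.
    by rewrite expr_div_n /b; field; rewrite !gt_eqF ?exprn_gt0 ?ltr0n.
  rewrite ler_pM2l// -exprVn lerXn2r ?nnegrE ?invr_ge0 ?divr_ge0//.
  rewrite ler_pdivlMr ?ltr0n// mulrC ler_pdivrMr//.
  by rewrite -natrM ler_nat mul2n -addnn -addn1 leq_add2l.
pose tau (k : nat) := t - Gam / k%:R.
have tauT k : (n0 <= k)%N -> t / 2 <= tau k.
  rewrite !geq_max => /andP[/andP[_ n3k] k1].
  have kR : 0 < k%:R :> R by rewrite ltr0n.
  have : Gam / k%:R <= t / 2.
    by have := H3 k n3k; rewrite !ler_pdivrMr//; lra.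
  by rewrite /tau; lra.
have tau_t k : tau k <= t.
  by rewrite gerBl divr_ge0// ltW.
have n01 : (0 < n0)%N by rewrite !leq_max orbT.
have descent x : dist 0 x <= 2 * shell m n0 ->
    forall k, (n0 <= k)%N -> dist (tau k) x <= 2 * shell m k.
  move=> x0; elim=> [|k IH].
    by rewrite leqn0 => /eqP n00; move: n01; rewrite n00.
  have tau0 j : (n0 <= j)%N -> 0 <= tau j.
    by move=> /tauT; apply: le_trans; exact: ltW.
  rewrite leq_eqVlt => /predU1P[<-|].
    by apply: le_trans x0; apply: dist_noninc => //; exact: tau0.
  rewrite ltnS => nk; have {}IH := IH nk.
  have k_gt0 : (0 < k)%N by exact: leq_trans nk.
  have kR : 0 < k%:R :> R by rewrite ltr0n.
  have n2k : (n2 <= k)%N.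
    by apply: leq_trans nk; rewrite /n0 !leq_max leqnn.
  rewrite leNgt; apply/negP => far.
  have tauS : tau k <= tau k.+1.
    rewrite lerD2l lerN2 ler_pM2l// lef_pV2 ?posrE ?ltr0n// ler_nat //.
  have far' u : tau k <= u <= tau k.+1 -> k%:R * k.+1%:R <= rate u (dist u x).
    move=> /andP[u1 u2]; have u0 : 0 <= u by apply: le_trans u1; exact: tau0.
    apply: H2 => //.
    - by apply: le_trans u1; exact: tauT.
    - by apply: lt_le_trans far _; exact: dist_noninc.
    - by apply: le_trans IH; apply: dist_noninc => //; exact: tau0.
  have := @dist_decay x (tau k) (tau k.+1) (k%:R * k.+1%:R) (tau0 _ nk) tauS
    (mulr_ge0 (ler0n _ _) (ler0n _ _)) (fun u hu _ => far' u hu).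
  have -> : k%:R * k.+1%:R * (tau k.+1 - tau k) = Gam.
    rewrite /tau -natr1; field; rewrite gt_eqF//= gt_eqF// addr_gt0//.
  move=> h; have h' : (1 + Gam) * dist (tau k.+1) x <= Gam * (2 * shell m k.+1).
    apply: le_trans h _; apply: le_trans IH _.
    by rewrite [leRHS]mulrCA ler_pM2l// shellS.
  have h2 : Gam * (2 * shell m k.+1) < Gam * dist (tau k.+1) x by rewrite ltr_pM2l.
  by move: (dist_ge0 (tau k.+1) x) h' h2; lra.
exists (2 * shell m n0); first by rewrite mulr_gt0// shell0.
move=> x x0; apply/eqP; rewrite eq_le dist_ge0 andbT leNgt; apply/negP => d0.
have d20 : 0 < dist t x / 2 by rewrite divr_gt0.
have [k Hk] := expr_small b0 b1 d20.
pose j := maxn k n0.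
have nj : (n0 <= j)%N by rewrite leq_maxr.
have h1 : dist t x <= 2 * shell m j.
  apply: le_trans (descent x x0 j nj); apply: dist_noninc => //.
  by apply: le_trans (tauT j nj); exact: ltW.
have h2 : shell m j <= b ^+ j.
  rewrite ler_pdivrMr ?exprn_gt0 ?ltr0n ?(leq_trans n01)//.
  by rewrite ler_peMr ?(ltW (bn0 _))// exprn_ege1// ler1n (leq_trans n01).
have := Hk j (leq_maxl _ _); rewrite ltr_pdivlMr//.
by lra.
Qed.

End concentration.

(** * The initial datum and the conclusion *)

(** A box inscribed in the shell between the radii [r / (2 d)] and [r] already
    carries this mass: its volume is a multiple of [r ^ d], and the powers of
    [r] cancel. *)
Lemma initial_mass_lower_bound (R : realType) (n : nat) (alpha c r0 beta : R)
    (mu : probability 'rV[R]_n.+2 R) (u : 'rV[R]_n.+2 -> R) :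
  0 < n.+2%:R + alpha - 2 -> 0 < c -> r0 <= 1 -> 0 < beta -> density_of mu u ->
  (forall x : 'rV[R]_n.+2, 0 < enorm x -> enorm x < r0 ->
     c / enorm x `^ (n.+2%:R + alpha - 2) * (1 / (- ln (enorm x)) `^ beta)
       <= u x) ->
  forall r, 0 < r -> r < r0 ->
    c / (2 * n.+2%:R) ^+ n.+2 / ln (4 * n.+2%:R / (2 * r)) `^ beta <=
    r `^ (alpha - 2) * fine (mu (eball r)).
Proof.
move=> gam0 c0 r01 beta0 [iu u0 muE] ulb r rr rr0.
set d : R := n.+2%:R; set gam := d + alpha - 2.
have d2 : 2 <= d by rewrite /d ler_nat.
have d0 : 0 < d by exact: lt_le_trans d2.
pose q := r / (2 * d).
have q0 : 0 < q by rewrite divr_gt0// mulr_gt0.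
have rE : r = d * (q + q) by rewrite /q; field; rewrite gt_eqF.
have qE : (4 * d / (2 * r)) = q^-1 by rewrite /q; field; rewrite !gt_eqF.
pose Q := @box R n.+1 q (q + q) q (q + q).
have mQ : measurable Q by exact: measurable_box_itv.
have QP x : Q x -> q <= enorm x /\ enorm x <= r.
  move=> Qx; have xi i : q <= x 0 i /\ x 0 i <= q + q.
    by have := Qx i; case: ifP => _; rewrite /= in_itv/= => /andP[h1 /ltW h2].
  split.
    by apply: le_trans (xi 0).1 _; apply: le_trans (enorm_coord x 0); exact: ler_norm.
  rewrite rE; apply: enorm_le_max => i; have [h1 h2] := xi i.
  by rewrite ger0_norm//; exact: le_trans (ltW q0) h1.
have q1 : q < 1.
  have h : q <= r by rewrite rE; nra.
  by apply: le_lt_trans h (lt_le_trans rr0 r01).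
have lq0 : 0 < ln q^-1 by rewrite ln_gt0// invf_gt1.
pose K := c / r `^ gam / (ln q^-1) `^ beta.
have Kle x : Q x -> K <= u x.
  move=> /QP[qx xr]; have x0 : 0 < enorm x by exact: lt_le_trans qx.
  have xr0 : enorm x < r0 by exact: le_lt_trans rr0.
  have x1 : enorm x < 1 by exact: lt_le_trans r01.
  apply: le_trans (ulb x x0 xr0); rewrite div1r -/d -/gam.
  have lx0 : 0 < - ln (enorm x) by rewrite oppr_gt0 ln_lt0// x0.
  apply: ler_pM; rewrite ?invr_ge0 ?powR_ge0//.
  - by rewrite divr_ge0 ?powR_ge0// ltW.
  - rewrite ler_pM2l// lef_pV2 ?posrE ?powR_gt0//.
    by apply: ge0_ler_powR; rewrite ?nnegrE ?(ltW gam0) ?(ltW x0) ?(ltW rr).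
  - rewrite lef_pV2 ?posrE ?powR_gt0//.
    apply: ge0_ler_powR; rewrite ?nnegrE ?(ltW beta0) ?(ltW lx0) ?(ltW lq0)//.
    by rewrite lnV ?posrE// lerN2 ler_ln ?posrE.
have K0 : 0 <= K by rewrite divr_ge0 ?powR_ge0// divr_ge0 ?powR_ge0// ltW.
have massQ : ((K * q ^+ n.+2)%:E <= mu (eball r))%E.
  apply: (@le_trans _ _ (mu Q)); last first.
    apply: le_measureS => //; first exact: measurable_eball.
    by move=> x /QP[].
  rewrite muE//.
  have -> : (K * q ^+ n.+2)%:E = (\int[lebesgue_rV n.+2]_(x in Q) K%:E)%E.
    have vQ : lebesgue_rV n.+2 Q = (q ^+ n.+2)%:E.
      by rewrite box_volume ?lerDl ?(ltW q0)// addrK -exprS.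
    by rewrite integral_cst//= vQ -EFinM.
  apply: ge0_le_integral => //.
  by apply: measurable_funTS; exact: measurable_int iu.
have mb : fine (mu (eball r)) >= K * q ^+ n.+2.
  by rewrite -lee_fin fineK//; apply: fin_num_measure; exact: measurable_eball.
rewrite qE; apply: (@le_trans _ _ (r `^ (alpha - 2) * (K * q ^+ n.+2))); last first.
  by rewrite ler_wpM2l// powR_ge0.
rewrite le_eqVlt; apply/orP; left; apply/eqP.
have powE : r `^ gam = r ^+ n.+2 * r `^ (alpha - 2).
  have -> : gam = n.+2%:R + (alpha - 2) by rewrite /gam /d addrA.
  rewrite (@powRD _ r n.+2%:R (alpha - 2)); last by rewrite (gt_eqF rr) implybT.
  by rewrite powR_mulrn// ltW.
rewrite /K powE.
have := powR_gt0 (alpha - 2) rr; have := powR_gt0 beta lq0.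
set X := _ `^ beta; set Y := r `^ _ => X0 Y0.
rewrite /q expr_div_n.
by field; rewrite !gt_eqF ?exprn_gt0 ?mulr_gt0.
Qed.

Theorem theorem3p1 (R : realType) (d : nat) (alpha : R)
    (rho_init : probability 'rV[R]_d R) (u_init : 'rV[R]_d -> R)
    (c r0 beta : R) (rho : R -> probability 'rV[R]_d R) :
  (2 <= d)%N ->
  2 - d%:R < alpha -> alpha < 2 ->
  PRD rho_init ->
  compact (msupport rho_init) ->
  rho_init `<< lebesgue_rV d ->
  density_of rho_init u_init ->
  0 < c ->
  0 < r0 -> r0 <= 1 ->
  (d%:R + alpha - 2) / d%:R < beta -> beta < 1 ->
  (forall x : 'rV[R]_d, 0 < enorm x -> enorm x < r0 ->
     c / enorm x `^ (d%:R + alpha - 2) * (1 / (- ln (enorm x)) `^ beta)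
       <= u_init x) ->
  PRD_curve rho ->
  lagrangian_solution alpha rho_init rho ->
  forall t : R, 0 < t -> (0 < rho t [set (0%R : 'rV[R]_d)])%E.
Proof.
case: d rho_init u_init rho => [|[|n]]// rho_init u_init rho _ alphad alpha2 _ _ _.
move=> dens c0 r00 r01 betal beta1 ulb [rhoP _].
move=> [sigma [sigma_cont sigma_push sigma_int]] t t0.
have gam0 : 0 < n.+2%:R + alpha - 2 by lra.
have beta0 : 0 < beta.
  by apply: lt_trans betal; rewrite divr_gt0.
have m0_lb := initial_mass_lower_bound gam0 c0 r01 beta0 dens ulb.
have B8 : 8 <= 4 * n.+2%:R :> R.
  have h2 : 2 <= n.+2%:R :> R by rewrite ler_nat.
  by lra.
have c10 : 0 < c / (2 * n.+2%:R) ^+ n.+2 by rewrite divr_gt0// exprn_gt0// mulr_gt0.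
have [C C0 lb] := rate_lower_bound alpha2 gam0 rhoP.
have s0 := sigma0 sigma_int.
have [r rr hr] := @reaches_origin R 'rV[R]_n.+2
  (fun s r => fine (rho s (eball r))) (rate alpha rho)
  (fun s x => enorm (sigma s x)) (fun r => fine (rho_init (eball r)))
  alpha (4 * n.+2%:R) C _ r0 beta alpha2 B8 C0 c10 r00 r01 beta0 beta1
  (fun s x => enorm_ge0 _) (fun s r => fine_ge0 (measure_ge0 _ _))
  (rate_ge0 alpha2 gam0 rhoP) lb
  (fun x a b lam a0 ab lam0 H => sigma_decay alpha2 gam0 rhoP sigma_cont sigma_int
     a0 ab lam0 (fun s sab sx => H s sab (etrans (enorm_gt0 _) sx)))
  (fun s r r' s0' H => mass_transport sigma_cont sigma_push s0'
     (fun x hx => H x (etrans (congr1 (fun z => enorm z <= r) (s0 x)) hx)))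
  m0_lb t t0.
have hball x : enorm x <= r -> sigma t x = 0.
  by move=> xr; apply/eqP; rewrite -enorm_eq0; apply/eqP; apply: hr; rewrite s0.
apply: lt_le_trans (mass_at_origin sigma_cont sigma_push (ltW t0) hball).
have rmin : exists2 r', 0 < r' & r' < r0 /\ r' <= r.
  exists (Num.min r (r0 / 2)); first by rewrite lt_min rr divr_gt0.
  split; last by rewrite ge_min lexx.
  by rewrite gt_min; apply/orP; right; lra.
have [r' r'0 [r'r0 r'r]] := rmin.
apply: (@lt_le_trans _ _ (rho_init (eball r'))); last first.
  apply: le_measureS; [exact: measurable_eball|exact: measurable_eball|].
  by move=> x; rewrite /eball /= => /le_trans; apply.
have mr : measurable (eball r' : set 'rV[R]_n.+2) by exact: measurable_eball.
rewrite -[ltRHS]fineK ?lte_fin; last exact: fin_num_measure.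
have lb0 : 0 < c / (2 * n.+2%:R) ^+ n.+2 / ln (4 * n.+2%:R / (2 * r')) `^ beta.
  rewrite divr_gt0// powR_gt0// ln_gt0// ltr_pdivlMr ?mulr_gt0//; lra.
have := lt_le_trans lb0 (m0_lb r' r'0 r'r0).
by rewrite pmulr_rgt0// powR_gt0.
Qed.
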